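(* $\mathsf{UC}_{\mathbb{N}^{\mathbb{N}}} <_{\mathrm{sW}} \mathsf{PST}_{2^{\mathbb{N}}} \equiv_{\mathrm{sW}} \mathsf{PST}_{\mathbb{N}^{\mathbb{N}}} <_{\mathrm{sW}} \mathsf{C}_{\mathbb{N}^{\mathbb{N}}}$.
   Context: A represented space is a set $X$ with a partial surjection $\delta_X:\subseteq\mathbb{N}^{\mathbb{N}}\to X$; $p$ is a name of $x$ if $\delta_X(p)=x$. A problem is a partial multi-valued function $f:\subseteq X\rightrightarrows Y$ between represented spaces. For problems $f,g$: $f\le_{\mathrm{sW}} g$ (strong Weihrauch reducibility) means that there are computable partial maps $\Phi,\Psi:\subseteq\mathbb{N}^{\mathbb{N}}\to\mathbb{N}^{\mathbb{N}}$ such that for every name $p$ of some $x\in\mathrm{dom}(f)$, $\Phi(p)$ is a name of some $y\in\mathrm{dom}(g)$, and for every name $q$ of an element of $g(y)$, $\Psi(q)$ is a name of an element of $f(x)$. $f\equiv_{\mathrm{sW}}g$ means $f\le_{\mathrm{sW}}g$ and $g\le_{\mathrm{sW}}f$; $f<_{\mathrm{sW}}g$ means $f\le_{\mathrm{sW}}g$ and $g\not\le_{\mathrm{sW}}f$. A tree is a nonempty subset $T$ of $\mathbb{N}^{<\mathbb{N}}$ closed under initial segments; a binary tree is a tree contained in $2^{<\mathbb{N}}$; $[T]$ is its set of infinite paths. $\mathcal{A}(\mathbb{N}^{\mathbb{N}})$ (resp. $\mathcal{A}(2^{\mathbb{N}})$) is the represented space of closed subsets of Baire space (resp. Cantor space),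 a name of $C$ being (the characteristic function of) a tree (resp. binary tree) $T$ with $[T]=C$; this is equivalent to the usual negative representation. $\mathbb{N}^{\mathbb{N}}$ and $2^{\mathbb{N}}$ are represented by the identity. A subset of a topological space is perfect if it is closed and has no isolated points. For $\mathcal{X}\in\{2^{\mathbb{N}},\mathbb{N}^{\mathbb{N}}\}$, $\mathsf{PST}_{\mathcal{X}}:\subseteq\mathcal{A}(\mathcal{X})\rightrightarrows\mathcal{A}(\mathcal{X})$ has domain $\{A:|A|>\aleph_0\}$ and $\mathsf{PST}_{\mathcal{X}}(A)=\{P\in\mathcal{A}(\mathcal{X}): P\subseteq A,\ P \text{ nonempty and perfect}\}$. $\mathsf{C}_{\mathbb{N}^{\mathbb{N}}}:\subseteq\mathcal{A}(\mathbb{N}^{\mathbb{N}})\rightrightarrows\mathbb{N}^{\mathbb{N}}$ has domain the nonempty closed sets and $\mathsf{C}_{\mathbb{N}^{\mathbb{N}}}(A)=A$. $\mathsf{UC}_{\mathbb{N}^{\mathbb{N}}}$ is its restriction to singletons. *)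

(* Defs.v *)
From Stdlib Require Cantor.
From mathcomp Require Import all_boot.
From mathcomp Require Import boolp classical_sets functions cardinality filter.
From mathcomp Require Import topology.

Set Implicit Arguments.
Unset Strict Implicit.
Unset Printing Implicit Defensive.

Local Open Scope classical_set_scope.

(* Baire space as the space of names; as a topological space, N^N is
   [pts nat] below. *)
Definition baire := nat -> nat.

(* Partial recursive functions relative to an oracle, in the unary presentation:
   several arguments are passed as one number through the Cantor pairing. *)

Definition cpair (m n : nat) : nat := Cantor.to_nat (m, n).

Inductive code : Type :=
| Zero | Succ | Fst | Snd | Oracle
| Pair of code & code
| Comp of code & code
| Rec of code & code
| Min of code.

(* Primitive recursion: R(a, 0) = F(a) and R(a, k+1) = G(a, (k, R(a, k))). *)
Fixpoint prim_rec (F G : nat -> nat -> Prop) (a k m : nat) : Prop :=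
  match k with
  | 0 => F a m
  | k'.+1 => exists r, prim_rec F G a k' r /\ G (cpair a (cpair k' r)) m
  end.

(* [eval p c n m]: the computation of c on input n with oracle p halts with
   output m. *)
Fixpoint eval (p : baire) (c : code) (n m : nat) : Prop :=
  match c with
  | Zero => m = 0
  | Succ => m = n.+1
  | Fst => m = (Cantor.of_nat n).1
  | Snd => m = (Cantor.of_nat n).2
  | Oracle => m = p n
  | Pair f g => exists a b, [/\ eval p f n a, eval p g n b & m = cpair a b]
  | Comp f g => exists a, eval p g n a /\ eval p f a m
  | Rec f g => prim_rec (eval p f) (eval p g)
                 (Cantor.of_nat n).1 (Cantor.of_nat n).2 m
  | Min f => eval p f (cpair n m) 0 /\
             forall i, i < m -> exists r, eval p f (cpair n i) r.+1
  end.

Lemma eval_functional p c n m1 m2 : eval p c n m1 -> eval p c n m2 -> m1 = m2.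
Proof.
elim: c n m1 m2 => [||||| f IHf g IHg | f IHf g IHg | f IHf g IHg | f IHf]
  n m1 m2 /=; try by move=> -> ->.
- by move=> [a [b [fa gb ->]]] [a' [b' [fa' gb' ->]]];
     rewrite (IHf _ _ _ fa fa') (IHg _ _ _ gb gb').
- by move=> [a [ga fa]] [b [gb]]; rewrite -(IHg _ _ _ ga gb); exact: IHf.
- elim: (Cantor.of_nat n).2 m1 m2 => [|k IHk] m1 m2 /=; first exact: IHf.
  by move=> [r [Rr Gr]] [s [Rs]]; rewrite -(IHk _ _ Rr Rs); exact: IHg.
- move=> [z1 lt1] [z2 lt2]; case: (ltngtP m1 m2) => // [/lt2|/lt1] [r fr].
    by have := IHf _ _ _ z1 fr.
  by have := IHf _ _ _ z2 fr.
Qed.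

(* F is computable if a single oracle program maps p to F(p), as a sequence, for
   all p in the domain; nothing is asked of the program outside the domain. *)
Definition computable (F : baire -> option baire) : Prop :=
  exists c : code, forall p q, F p = Some q -> forall n, eval p c n (q n).

(* The partial surjection from names to points is given by its graph. *)
Record repSpace := RepSpace {
  point :> Type;
  name : baire -> point -> Prop;
  name_functional : forall p x y, name p x -> name p y -> x = y;
  name_surjective : forall x, exists p, name p x }.

Record problem (X Y : repSpace) := Problem {
  pdom : set X;
  pval : X -> set Y }.

Definition sW_le (X Y Z W : repSpace) (f : problem X Y) (g : problem Z W) :=
  exists Phi Psi : baire -> option baire,
  [/\ computable Phi, computable Psi &
   forall p x, name p x -> pdom f x ->
   exists p' y, [/\ Phi p = Some p', name p' y, pdom g y &
     forall q z, name q z -> pval g y z ->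
     exists q' w, [/\ Psi q = Some q', name q' w & pval f x w]]].

Definition sW_equiv (X Y Z W : repSpace) (f : problem X Y) (g : problem Z W) :=
  sW_le f g /\ sW_le g f.

Definition sW_lt (X Y Z W : repSpace) (f : problem X Y) (g : problem Z W) :=
  sW_le f g /\ ~ sW_le g f.

Definition tree (T : pred (seq nat)) : Prop :=
  (exists s, T s) /\ forall s t, prefix s t -> T t -> T s.

(* Infinite sequences over a discrete alphabet D, with the product topology.
   An injection [dig] reads letters as numbers, so that finite words over D are
   elements of N^{<N}: N^N is the case D = nat, dig = id, and 2^N is the case
   D = bool, dig = nat_of_bool. *)
Definition pts (D : discreteTopologicalType) := {ptws nat -> D}.

Section Closed.
Variables (D : discreteTopologicalType) (dig : D -> nat).

Definition tree_over (T : pred (seq nat)) : Prop :=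
  tree T /\ forall s, T s -> exists u : seq D, s = map dig u.

Definition paths (T : pred (seq nat)) : set (pts D) :=
  [set x | forall n, T (map dig (mkseq x n))].

Record closed_set := ClosedSet {
  cset :> set (pts D);
  cset_closed : closed cset }.

Definition closed_name (p : baire) (C : closed_set) : Prop :=
  exists T : pred (seq nat),
  [/\ tree_over T, forall s, p (CodeSeq.code s) = T s :> nat & paths T = C].

Lemma closed_name_functional p C C' :
  closed_name p C -> closed_name p C' -> C = C'.
Proof.
move=> [T [_ pT TC]] [T' [_ pT' TC']].
have eT : T = T'.
  apply/funext => s; have := pT s; rewrite pT'.
  by case: (T s); case: (T' s).
case: C C' TC TC' => [C cC] [C' cC'] /= TC TC'.
have eC : C = C' by rewrite -TC -TC' eT.
by move: cC; rewrite eC => cC; rewrite (Prop_irrelevance cC cC').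
Qed.

Hypothesis dig_inj : injective dig.

Lemma closed_name_surjective C : exists p, closed_name p C.
Proof.
pose T : pred (seq nat) := fun s =>
  `[< s = [::] \/ exists2 x, cset C x & exists n, s = map dig (mkseq x n) >].
exists (fun k => T (CodeSeq.decode k) : nat), T; split.
- split; first split.
  + by exists [::]; apply/asboolP; left.
  + move=> s t /prefixP[u ->] /asboolP Tt; apply/asboolP.
    case: Tt => [|[x Cx [n e]]].
      by case: s => // _; left.
    right; exists x => //; exists (size s).
    have le : size s <= n.
      by rewrite -(size_mkseq x n) -(size_map dig) -e size_cat leq_addr.
    have := congr1 (take (size s)) e.
    rewrite take_size_cat // => ->; rewrite -map_take /mkseq -map_take.
    by rewrite take_iota (minn_idPl le) size_map size_map size_iota.
  + move=> s /asboolP[->|[x _ [n ->]]]; first by exists [::].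
    by eexists.
- by move=> s; rewrite CodeSeq.codeK.
- apply/seteqP; split=> [x Tx|x Cx n]; last first.
    by apply/asboolP; right; exists x => //; exists n.
  have H n : exists y, cset C y /\ forall i, i < n.+1 -> y i = x i.
    have /asboolP[|[y Cy [m e]]] := Tx n.+1; first by [].
    exists y; split=> // i ltin.
    have em : m = n.+1 by have := congr1 size e; rewrite !size_map !size_iota.
    have e' := inj_map dig_inj e.
    have := congr1 (fun s => nth (x i) s i) e'.
    by rewrite em !nth_mkseq.
  have [y Hy] := choice H.
  have cvy : y @ \oo --> x.
    apply/cvg_sup => i; apply/cvg_image;
      first by apply/seteqP; split=> // d _; exists (fun=> d).
    move=> A; rewrite nbhs_principalE => /principal_filterP Ax.
    exists [set z : pts D | A (z i)].
      exists i => // n /= lein; rewrite (Hy n).2 //; exact: leqW.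
    by apply/seteqP; split=> [d [z Az <-] //|d Ad]; exists (fun=> d).
  apply: (@closed_cvg _ _ \oo _ y (cset C)) cvy => //; first exact: cset_closed.
  by exists 0 => // n _; exact: (Hy n).1.
Qed.

Definition closed_space : repSpace :=
  RepSpace closed_name_functional closed_name_surjective.

Definition PST : problem closed_space closed_space :=
  @Problem closed_space closed_space
  (fun A : closed_set => ~ countable A)
  (fun (A : closed_set) (P : closed_set) =>
     [/\ P `<=` A, P !=set0 & perfect_set P]).

End Closed.

Lemma nat_of_bool_inj : injective nat_of_bool.
Proof. by move=> [] []. Qed.

Definition PST_cantor := PST nat_of_bool_inj.
Definition PST_baire := PST (@inj_id nat).

Definition baire_space : repSpace := @RepSpace (pts nat) (fun p x => p = x)
  (fun p x y ex ey => etrans (esym ex) ey)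
  (fun x => ex_intro _ x erefl).

Definition C_baire : problem (closed_space (@inj_id nat)) baire_space :=
  @Problem (closed_space (@inj_id nat)) baire_space
  (fun A : closed_set nat => A !=set0)
  (fun A : closed_set nat => cset A).

Definition UC_baire : problem (closed_space (@inj_id nat)) baire_space :=
  @Problem (closed_space (@inj_id nat)) baire_space
  (fun A : closed_set nat => exists x, cset A = [set x])
  (pval C_baire).

(* Main.v *)
(* Reductions. A word s of numbers is written 1^(s_0) 0 1^(s_1) 0 ... in Cantor
   space. The sequences of bits that code no point of Baire space are countably
   many, so a perfect set meets the coded points densely, whence PST on Baire space
   reduces to PST on Cantor space. A unique path v is blown up to the compact
   perfect set of the w with w(i)/2 = v(i), and a tree for any perfect subset of
   its code gives back v by compactness. Finally the perfect subtrees of a tree,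
   with witnesses of splitting, form a closed subset of Baire space.

   Separations. Only continuity of the reductions is used. Emptiness of a closed
   set is coanalytic, and comparing ranks of trees turns two such conditions, on
   the name p of an instance, into closed sets A0(p), A1(p), at least one of which
   is inhabited; as a tree may delay its decisions, p can be chosen to name the
   instance built from A0(p) and A1(p). Choice on Baire space does not reduce to
   PST: the first digit of an answer is forced by a finite part of the name of the
   perfect kernel, and it is a coanalytic condition that some finite part excluding
   only strings outside of the kernel forces the digit b; the instance has no
   solution with the digit whose condition wins the comparison. PST on Cantor space
   does not reduce to unique choice: as the chosen point v is unique, whether the
   set given by v meets the half b of Cantor space is both analytic and coanalytic
   in p, and the instance is uncountable only in the half that v does not select. *)
From Pilot Require Import Defs.
From Stdlib Require Cantor.
From mathcomp Require Import all_boot.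
From mathcomp Require Import boolp classical_sets functions cardinality filter.
From mathcomp Require Import topology.
(* Again, because [topology] has an [eval] of its own. *)
Import Pilot.Defs.

Set Implicit Arguments.
Unset Strict Implicit.
Unset Printing Implicit Defensive.

(** * Functions recursive in an oracle *)

Class coded (A : Type) := encode : A -> nat.
#[global] Instance coded_nat : coded nat := id.
#[global] Instance coded_bool : coded bool := nat_of_bool.
#[global] Instance coded_seq : coded (seq nat) := CodeSeq.code.
#[global] Instance coded_prod A B (cA : coded A) (cB : coded B) : coded (A * B) :=
  fun x => cpair (encode x.1) (encode x.2).

(** Totality for every oracle makes this class closed under composition. The one partial map
    constructed below comes from [computable_search]. *)
Definition recursive {E A : Type} {cE : coded E} {cA : coded A}
    (f : baire -> E -> A) : Prop :=
  exists c, forall p e, eval p c (encode e) (encode (f p e)).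

Lemma of_cpair m n : Cantor.of_nat (cpair m n) = (m, n).
Proof. exact: Cantor.cancel_of_to. Qed.

Lemma cpair_of n : cpair (Cantor.of_nat n).1 (Cantor.of_nat n).2 = n.
Proof. by rewrite /cpair -surjective_pairing Cantor.cancel_to_of. Qed.

Lemma rec_ext E A {cE : coded E} {cA : coded A} (f g : baire -> E -> A) :
  (forall p e, f p e = g p e) -> recursive f -> recursive g.
Proof. by move=> fg [c Hc]; exists c => p e; rewrite -fg. Qed.

Lemma rec_comp E F A {cE : coded E} {cF : coded F} {cA : coded A}
    (g : baire -> F -> A) (f : baire -> E -> F) :
  recursive g -> recursive f -> recursive (fun p e => g p (f p e)).
Proof.
move=> [c Hc] [d Hd]; exists (Comp c d) => p e /=.
by exists (encode (f p e)).
Qed.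

Lemma rec_id E {cE : coded E} : recursive (fun _ (e : E) => e).
Proof.
exists (Comp Fst (Pair (Pair Fst Snd) Zero)) => p e /=.
exists (cpair (encode e) 0); rewrite of_cpair; split=> //.
exists (encode e), 0; split=> //.
by do 2!eexists; split; [exact: erefl|exact: erefl|rewrite cpair_of].
Qed.

Lemma rec_const E A {cE : coded E} {cA : coded A} (a : A) :
  recursive (fun _ (_ : E) => a).
Proof.
have H n : exists c, forall p (e : E), eval p c (encode e) n.
  elim: n => [|n [c Hc]]; first by exists Zero.
  by exists (Comp Succ c) => p e; exists n.
exact: H.
Qed.

Lemma rec_pair E A B {cE : coded E} {cA : coded A} {cB : coded B}
    (f : baire -> E -> A) (g : baire -> E -> B) :
  recursive f -> recursive g -> recursive (fun p e => (f p e, g p e)).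
Proof.
move=> [c Hc] [d Hd]; exists (Pair c d) => p e /=.
by exists (encode (f p e)), (encode (g p e)).
Qed.

Lemma rec_fst E A B {cE : coded E} {cA : coded A} {cB : coded B}
    (f : baire -> E -> A * B) : recursive f -> recursive (fun p e => (f p e).1).
Proof.
by move=> [c Hc]; exists (Comp Fst c) => p e /=; exists (encode (f p e));
   rewrite of_cpair.
Qed.

Lemma rec_snd E A B {cE : coded E} {cA : coded A} {cB : coded B}
    (f : baire -> E -> A * B) : recursive f -> recursive (fun p e => (f p e).2).
Proof.
by move=> [c Hc]; exists (Comp Snd c) => p e /=; exists (encode (f p e));
   rewrite of_cpair.
Qed.

Lemma rec_succ E {cE : coded E} (f : baire -> E -> nat) :
  recursive f -> recursive (fun p e => (f p e).+1).
Proof. by move=> [c Hc]; exists (Comp Succ c) => p e /=; exists (f p e). Qed.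

Lemma rec_oracle E {cE : coded E} (f : baire -> E -> nat) :
  recursive f -> recursive (fun p e => p (f p e)).
Proof. by move=> [c Hc]; exists (Comp Oracle c) => p e /=; exists (f p e). Qed.

Lemma rec_code E {cE : coded E} (f : baire -> E -> seq nat) :
  recursive f -> recursive (fun p e => CodeSeq.code (f p e)).
Proof. by []. Qed.

Lemma rec_decode E {cE : coded E} (f : baire -> E -> nat) :
  recursive f -> recursive (fun p e => CodeSeq.decode (f p e)).
Proof.
by move=> [c Hc]; exists c => p e; rewrite /encode /coded_seq CodeSeq.decodeK.
Qed.

Lemma rec_cpair E {cE : coded E} (f g : baire -> E -> nat) :
  recursive f -> recursive g -> recursive (fun p e => cpair (f p e) (g p e)).
Proof. exact: rec_pair. Qed.

Lemma rec_of_nat E {cE : coded E} (f : baire -> E -> nat) :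
  recursive f -> recursive (fun p e => Cantor.of_nat (f p e)).
Proof.
by move=> [c Hc]; exists c => p e; rewrite /encode /coded_prod /encode /= cpair_of.
Qed.

Lemma rec_bool_nat E {cE : coded E} (f : baire -> E -> bool) :
  recursive f -> recursive (fun p e => nat_of_bool (f p e)).
Proof. by []. Qed.

Lemma rec_iteri E A {cE : coded E} {cA : coded A} (n : baire -> E -> nat)
    (g : baire -> E -> nat -> A -> A) (a : baire -> E -> A) :
  recursive n -> recursive (fun p (e : E * (nat * A)) => g p e.1 e.2.1 e.2.2) ->
  recursive a ->
  recursive (fun p e => iteri (n p e) (g p e) (a p e)).
Proof.
move=> [cn Hn] [cg Hg] [ca Ha]; have [ci Hi] := @rec_id E _.
exists (Comp (Rec ca cg) (Pair ci cn)) => p e /=.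
exists (cpair (encode e) (n p e)); split; first by exists (encode e), (n p e).
rewrite of_cpair /=; elim: (n p e) => [|m IHm] /=; first exact: Ha.
by eexists; split; [exact: IHm|exact: (Hg p (e, (m, _)))].
Qed.

Lemma rec_weak E F A {cE : coded E} {cF : coded F} {cA : coded A}
    (f : baire -> E -> A) :
  recursive f -> recursive (fun p (e : E * F) => f p e.1).
Proof. by move=> cf; apply: (rec_comp cf); apply: rec_fst; exact: rec_id. Qed.

Lemma rec_if E A {cE : coded E} {cA : coded A} (b : baire -> E -> bool)
    (x y : baire -> E -> A) :
  recursive b -> recursive x -> recursive y ->
  recursive (fun p e => if b p e then x p e else y p e).
Proof.
move=> cb cx cy; pose n p e := nat_of_bool (b p e).
apply: (@rec_ext _ _ _ _ (fun p e => iteri (n p e) (fun _ _ => x p e) (y p e))).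
  by move=> p e; rewrite /n; case: (b p e).
by apply: rec_iteri => //; exact: rec_weak.
Qed.

Lemma rec_comp2 E A B C {cE : coded E} {cA : coded A} {cB : coded B}
    {cC : coded C} (g : baire -> A -> B -> C)
    (a : baire -> E -> A) (b : baire -> E -> B) :
  recursive (fun p (e : A * B) => g p e.1 e.2) -> recursive a -> recursive b ->
  recursive (fun p e => g p (a p e) (b p e)).
Proof.
move=> cg ca cb; have [c Hc] := rec_comp cg (rec_pair ca cb).
by exists c => p e; have := Hc p e.
Qed.

Lemma rec_comp3 E A B C D {cE : coded E} {cA : coded A} {cB : coded B}
    {cC : coded C} {cD : coded D} (g : baire -> A -> B -> C -> D)
    (a : baire -> E -> A) (b : baire -> E -> B) (c : baire -> E -> C) :
  recursive (fun p (e : A * (B * C)) => g p e.1 e.2.1 e.2.2) ->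
  recursive a -> recursive b -> recursive c ->
  recursive (fun p e => g p (a p e) (b p e) (c p e)).
Proof.
move=> cg ca cb cc; have [d Hd] := rec_comp cg (rec_pair ca (rec_pair cb cc)).
by exists d => p e; have := Hd p e.
Qed.

(** [rec_more] is enlarged after each group of closure properties, so that [rec_auto] follows the
    syntax of more and more functions. *)
Ltac rec_more := fail.
Ltac rec_step :=
  first
  [ simple eapply rec_id
  | simple eapply rec_const
  | assumption
  | match goal with
    | H : recursive ?f |- recursive (fun p e => ?f p (@?h p e)) =>
        simple eapply (rec_comp (g := f) (f := h) H)
    | H : recursive (fun p e => ?f p (fst e) (snd e))
        |- recursive (fun p e => ?f p (@?a p e) (@?b p e)) =>
        simple eapply (rec_comp2 (g := f) (a := a) (b := b) H)
    | H : recursive (fun p e => ?f p (fst e) (fst (snd e)) (snd (snd e)))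
        |- recursive (fun p e => ?f p (@?a p e) (@?b p e) (@?c p e)) =>
        simple eapply (rec_comp3 (g := f) (a := a) (b := b) (c := c) H)
    end
  | simple eapply rec_pair | simple eapply rec_fst | simple eapply rec_snd
  | simple eapply rec_succ | simple eapply rec_oracle
  | simple eapply rec_code | simple eapply rec_decode | simple eapply rec_cpair
  | simple eapply rec_of_nat | simple eapply rec_bool_nat
  | simple eapply rec_if | simple eapply rec_iteri | rec_more ].
Ltac rec_auto := intros; repeat (cbn beta; rec_step).

Lemma rec_pred E {cE : coded E} (f : baire -> E -> nat) :
  recursive f -> recursive (fun p e => (f p e).-1).
Proof.
move=> cf; apply: (@rec_ext _ _ _ _
   (fun p e => iteri (f p e) (fun i _ => i) 0)).
  by move=> p e; case: (f p e).
rec_auto.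
Qed.

Lemma rec_add E {cE : coded E} (f g : baire -> E -> nat) :
  recursive f -> recursive g -> recursive (fun p e => f p e + g p e).
Proof.
move=> cf cg; apply: (@rec_ext _ _ _ _ (fun p e => iteri (f p e) (fun _ => S) (g p e))).
  by move=> p e; elim: (f p e) => //= n ->.
rec_auto.
Qed.

Lemma rec_mul E {cE : coded E} (f g : baire -> E -> nat) :
  recursive f -> recursive g -> recursive (fun p e => f p e * g p e).
Proof.
move=> cf cg; apply: (@rec_ext _ _ _ _
  (fun p e => iteri (f p e) (fun _ x => iteri (g p e) (fun _ => S) x) 0)).
  move=> p e; elim: (f p e) => //= n ->; rewrite mulSn.
  by elim: (g p e) (_ * _) => //= m IH k; rewrite IH.
rec_auto.
Qed.

Lemma rec_exp E {cE : coded E} (f g : baire -> E -> nat) :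
  recursive f -> recursive g -> recursive (fun p e => f p e ^ g p e).
Proof.
move=> cf cg.
apply: (@rec_ext _ _ _ _
  (fun p e => iteri (g p e) (fun _ x => f p e * x) 1)).
  by move=> p e; elim: (g p e) => //= n ->; rewrite expnS.
rec_auto. simple eapply rec_mul; rec_auto.
Qed.

Lemma rec_sub E {cE : coded E} (f g : baire -> E -> nat) :
  recursive f -> recursive g -> recursive (fun p e => f p e - g p e).
Proof.
move=> cf cg; apply: (@rec_ext _ _ _ _
  (fun p e => iteri (g p e) (fun _ x => x.-1) (f p e))).
  by move=> p e; elim: (g p e) => [|n IH] /=; rewrite ?subn0 // IH subnS.
rec_auto; simple eapply rec_pred; rec_auto.
Qed.

Ltac rec_arith := first [ simple eapply rec_pred | simple eapply rec_add
  | simple eapply rec_mul | simple eapply rec_exp | simple eapply rec_sub ].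
Ltac rec_more ::= rec_arith.

Lemma rec_eq0 E {cE : coded E} (f : baire -> E -> nat) :
  recursive f -> recursive (fun p e => f p e == 0).
Proof.
move=> cf; apply: (@rec_ext _ _ _ _
   (fun p e => iteri (f p e) (fun _ _ => false) true)).
  by move=> p e; case: (f p e).
rec_auto.
Qed.

Lemma rec_leq E {cE : coded E} (f g : baire -> E -> nat) :
  recursive f -> recursive g -> recursive (fun p e => f p e <= g p e).
Proof. by move=> cf cg; apply: rec_eq0; rec_auto. Qed.

Lemma rec_neg E {cE : coded E} (b : baire -> E -> bool) :
  recursive b -> recursive (fun p e => ~~ b p e).
Proof.
move=> cb; apply: (@rec_ext _ _ _ _ (fun p e => if b p e then false else true)).
  by move=> p e; case: (b p e).
rec_auto.
Qed.

Lemma rec_and E {cE : coded E} (b c : baire -> E -> bool) :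
  recursive b -> recursive c -> recursive (fun p e => b p e && c p e).
Proof. by move=> cb cc; rewrite /andb; rec_auto. Qed.

Lemma rec_or E {cE : coded E} (b c : baire -> E -> bool) :
  recursive b -> recursive c -> recursive (fun p e => b p e || c p e).
Proof. by move=> cb cc; rewrite /orb; rec_auto. Qed.

Lemma rec_imp E {cE : coded E} (b c : baire -> E -> bool) :
  recursive b -> recursive c -> recursive (fun p e => b p e ==> c p e).
Proof. by move=> cb cc; rewrite /implb; rec_auto. Qed.

Lemma rec_eqn E {cE : coded E} (f g : baire -> E -> nat) :
  recursive f -> recursive g -> recursive (fun p e => f p e == g p e).
Proof.
move=> cf cg; apply: (@rec_ext _ _ _ _
  (fun p e => (f p e <= g p e) && (g p e <= f p e))).
  by move=> p e; rewrite -eqn_leq.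
by apply: rec_and; apply: rec_leq.
Qed.

Definition all_lt (n : nat) (P : nat -> bool) : bool :=
  iteri n (fun i b => P i && b) true.

Lemma all_ltP n (P : nat -> bool) : reflect (forall i, i < n -> P i) (all_lt n P).
Proof.
elim: n => [|n IHn] /=; first by left.
apply: (iffP andP) => [[Pn /IHn H] i|H].
  by rewrite ltnS leq_eqVlt => /orP[/eqP->|/H].
by split; [exact: H|apply/IHn => i /leqW /H].
Qed.

Ltac rec_bool := first [ simple eapply rec_leq | simple eapply rec_eqn
  | simple eapply rec_neg | simple eapply rec_and | simple eapply rec_or
  | simple eapply rec_imp ].
Ltac rec_more ::= first [ rec_arith | rec_bool ].

Lemma rec_all_lt E {cE : coded E} (n : baire -> E -> nat)
    (P : baire -> E -> nat -> bool) :
  recursive n -> recursive (fun p (e : E * nat) => P p e.1 e.2) ->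
  recursive (fun p e => all_lt (n p e) (P p e)).
Proof.
by move=> cn cP; rewrite /all_lt; rec_auto.
Qed.

(** Unbounded search for the least number that passes a recursive test. Negating the test turns
    success into the zero that [Min] looks for. *)
Lemma rec_min E A {cE : coded E} {cA : coded A} (f : baire -> E -> A)
    (P : baire -> E -> nat -> bool) :
  recursive (fun p (e : E * nat) => P p e.1 e.2) ->
  (forall p e, P p e (encode (f p e)) /\
     forall i, i < encode (f p e) -> ~~ P p e i) ->
  recursive f.
Proof.
move=> /rec_neg[c Hc] Pf; exists (Min c) => p e /=.
have Hi i : eval p c (cpair (encode e) i) (nat_of_bool (~~ P p e i)).
  exact: (Hc p (e, i)).
have [Pe Pl] := Pf p e; split.
  have <- : nat_of_bool (~~ P p e (encode (f p e))) = 0 by rewrite Pe.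
  exact: Hi.
by move=> i /Pl nP; exists 0; have := Hi i; rewrite nP.
Qed.

Lemma code_cons n s : CodeSeq.code (n :: s) = 2 ^ n * (CodeSeq.code s).*2.+1.
Proof. by []. Qed.

Lemma rec_cons E {cE : coded E} (f : baire -> E -> nat)
    (s : baire -> E -> seq nat) :
  recursive f -> recursive s -> recursive (fun p e => f p e :: s p e).
Proof.
move=> cf cs.
have [c Hc] : recursive (fun p e => 2 ^ f p e * (CodeSeq.code (s p e) * 2).+1).
  by rec_auto.
by exists c => p e; have := Hc p e; rewrite muln2.
Qed.

Ltac rec_more ::= first [ rec_arith | rec_bool | simple eapply rec_all_lt
  | simple eapply rec_cons ].

(** Head and tail are found by searching for the pair whose [cons] has the given code; coding is
    injective, so no smaller pair passes. The empty word has code 0 and accepts the pair coded by 0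
    at once. *)
Lemma rec_uncons E {cE : coded E} (s : baire -> E -> seq nat) :
  recursive s -> recursive (fun p e => (head 0 (s p e), behead (s p e))).
Proof.
move=> cs; pose P p e m := (CodeSeq.code (s p e) == 0) ||
  (CodeSeq.code (s p e)
     == CodeSeq.code ((Cantor.of_nat m).1 :: CodeSeq.decode (Cantor.of_nat m).2)).
apply: (@rec_min _ _ _ _ _ P).
  by rewrite /P; rec_auto.
move=> p e; rewrite /P /encode /= /coded_prod /encode /= /encode of_cpair.
case: (s p e) => [|n t] //=; rewrite CodeSeq.codeK -!code_cons eqxx orbT.
split=> // i lti; rewrite negb_or; apply/andP; split.
  by rewrite -lt0n muln_gt0 expn_gt0.
apply: contraTN lti; rewrite -code_cons => /eqP /(can_inj CodeSeq.codeK) [-> ->].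
by rewrite /coded_seq CodeSeq.decodeK cpair_of ltnn.
Qed.

Lemma rec_head E {cE : coded E} (s : baire -> E -> seq nat) :
  recursive s -> recursive (fun p e => head 0 (s p e)).
Proof. by move=> /rec_uncons /rec_fst. Qed.

Lemma rec_behead E {cE : coded E} (s : baire -> E -> seq nat) :
  recursive s -> recursive (fun p e => behead (s p e)).
Proof. by move=> /rec_uncons /rec_snd. Qed.

Ltac rec_list := first [ simple eapply rec_all_lt | simple eapply rec_cons
  | simple eapply rec_head | simple eapply rec_behead ].
Ltac rec_more ::= first [ rec_arith | rec_bool | rec_list ].

Lemma size_code s : size s <= CodeSeq.code s.
Proof.
elim: s => // n s IHs; rewrite code_cons (leq_trans _ (leq_pmull _ _)) ?expn_gt0 //.
by rewrite ltnS (leq_trans IHs) // -addnn leq_addr.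
Qed.

Lemma rec_iter E A {cE : coded E} {cA : coded A} (n : baire -> E -> nat)
    (g : baire -> E -> A -> A) (a : baire -> E -> A) :
  recursive n -> recursive (fun p (e : E * A) => g p e.1 e.2) -> recursive a ->
  recursive (fun p e => iter (n p e) (g p e) (a p e)).
Proof.
move=> cn cg ca; apply: (@rec_ext _ _ _ _
  (fun p e => iteri (n p e) (fun _ => g p e) (a p e))).
  by move=> p e; elim: (n p e) => //= m ->.
rec_auto.
Qed.

(** Recursion along a word iterates a step on the pair of accumulator and remaining word. By
    [size_code], as many rounds as the code of the word suffice, since the pair is stationary once
    the word is used up. *)
Lemma rec_foldl E A {cE : coded E} {cA : coded A}
    (g : baire -> E -> A -> nat -> A) (a : baire -> E -> A)
    (s : baire -> E -> seq nat) :
  recursive (fun p (e : E * (A * nat)) => g p e.1 e.2.1 e.2.2) ->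
  recursive a -> recursive s ->
  recursive (fun p e => foldl (g p e) (a p e) (s p e)).
Proof.
move=> cg ca cs.
pose st p e (x : A * seq nat) :=
  if CodeSeq.code x.2 == 0 then x else (g p e x.1 (head 0 x.2), behead x.2).
have stn p e : forall n s a, size s <= n ->
    iter n (st p e) (a, s) = (foldl (g p e) a s, [::]).
  elim=> [|n IHn] [|k t] b // lt; rewrite iterSr.
    by rewrite /st /= -/(st p e) IHn.
  rewrite [st p e _]/st eqn0Ngt muln_gt0 expn_gt0 /=; exact: IHn.
apply: (@rec_ext _ _ _ _ (fun p e =>
  (iter (CodeSeq.code (s p e)) (st p e) (a p e, s p e)).1)).
  by move=> p e; rewrite stn // size_code.
rewrite /st; simple eapply rec_fst; simple eapply rec_iter; rec_auto.
Qed.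

Ltac rec_fold := first [ simple eapply rec_iter | simple eapply rec_foldl ].
Ltac rec_more ::= first [ rec_arith | rec_bool | rec_list | rec_fold ].

Lemma rec_rev E {cE : coded E} (s : baire -> E -> seq nat) :
  recursive s -> recursive (fun p e => rev (s p e)).
Proof.
move=> cs; apply: (@rec_ext _ _ _ _
  (fun p e => foldl (fun t x => x :: t) [::] (s p e))).
  by move=> p e; rewrite /rev; elim: (s p e) [::] => //= x t IH u.
rec_auto.
Qed.

Lemma rec_foldr E A {cE : coded E} {cA : coded A}
    (g : baire -> E -> nat -> A -> A) (a : baire -> E -> A)
    (s : baire -> E -> seq nat) :
  recursive (fun p (e : E * (nat * A)) => g p e.1 e.2.1 e.2.2) ->
  recursive a -> recursive s ->
  recursive (fun p e => foldr (g p e) (a p e) (s p e)).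
Proof.
move=> cg ca cs; apply: (@rec_ext _ _ _ _
  (fun p e => foldl (fun z x => g p e x z) (a p e) (rev (s p e)))).
  by move=> p e; rewrite foldl_rev.
rec_auto; exact: rec_rev.
Qed.

Lemma rec_size E {cE : coded E} (s : baire -> E -> seq nat) :
  recursive s -> recursive (fun p e => size (s p e)).
Proof.
move=> cs; apply: (@rec_ext _ _ _ _
  (fun p e => foldl (fun n _ => n.+1) 0 (s p e))).
  move=> p e; rewrite -[RHS]addn0; elim: (s p e) 0 => //= x t IH n.
  by rewrite IH addSnnS.
rec_auto.
Qed.

Lemma rec_nth E {cE : coded E} (s : baire -> E -> seq nat)
    (n : baire -> E -> nat) :
  recursive s -> recursive n -> recursive (fun p e => nth 0 (s p e) (n p e)).
Proof.
move=> cs cn; apply: (@rec_ext _ _ _ _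
  (fun p e => head 0 (iter (n p e) behead (s p e)))).
  move=> p e; elim: (n p e) (s p e) => [|m IH] t; first by rewrite nth0.
  by rewrite iterSr IH nth_behead.
rec_auto.
Qed.

Lemma rec_cat E {cE : coded E} (s t : baire -> E -> seq nat) :
  recursive s -> recursive t -> recursive (fun p e => s p e ++ t p e).
Proof.
move=> cs ct; apply: (@rec_ext _ _ _ _
  (fun p e => foldr (fun x u => x :: u) (t p e) (s p e))).
  by move=> p e; elim: (s p e) => //= x u ->.
simple eapply rec_foldr; rec_auto.
Qed.

Lemma rec_map E {cE : coded E} (g : baire -> E -> nat -> nat)
    (s : baire -> E -> seq nat) :
  recursive (fun p (e : E * nat) => g p e.1 e.2) -> recursive s ->
  recursive (fun p e => map (g p e) (s p e)).
Proof.
move=> cg cs; apply: (@rec_ext _ _ _ _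
  (fun p e => foldr (fun x u => g p e x :: u) [::] (s p e))).
  by move=> p e; elim: (s p e) => //= x u ->.
simple eapply rec_foldr; rec_auto.
Qed.

Lemma rec_all E {cE : coded E} (b : baire -> E -> nat -> bool)
    (s : baire -> E -> seq nat) :
  recursive (fun p (e : E * nat) => b p e.1 e.2) -> recursive s ->
  recursive (fun p e => all (b p e) (s p e)).
Proof.
move=> cb cs; apply: (@rec_ext _ _ _ _
  (fun p e => foldr (fun x c => b p e x && c) true (s p e))).
  by move=> p e; elim: (s p e) => //= x u ->.
simple eapply rec_foldr; rec_auto.
Qed.

Lemma rec_nseq E {cE : coded E} (n x : baire -> E -> nat) :
  recursive n -> recursive x -> recursive (fun p e => nseq (n p e) (x p e)).
Proof.
move=> cn cx; apply: (@rec_ext _ _ _ _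
  (fun p e => iter (n p e) (cons (x p e)) [::])).
  by move=> p e; elim: (n p e) => //= m ->.
rec_auto.
Qed.

Lemma rec_prefix E {cE : coded E} (s t : baire -> E -> seq nat) :
  recursive s -> recursive t -> recursive (fun p e => prefix (s p e) (t p e)).
Proof.
move=> cs ct; apply: (@rec_ext _ _ _ _ (fun p e =>
  (foldl (fun (x : bool * seq nat) k =>
            (x.1 && ((0 < size x.2) && (head 0 x.2 == k)), behead x.2))
         (true, t p e) (s p e)).1)).
  move=> p e; rewrite -[RHS]andTb.
  elim: (s p e) true (t p e) => [|k u IH] b [|x v] //=; rewrite ?andbT //.
    by rewrite IH !andbF.
  by rewrite IH andbA eq_sym.
rec_auto; simple eapply rec_size; rec_auto.
Qed.

Ltac rec_seq := first [ simple eapply rec_rev | simple eapply rec_size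
  | simple eapply rec_nth | simple eapply rec_foldr | simple eapply rec_cat
  | simple eapply rec_map | simple eapply rec_all | simple eapply rec_nseq
  | simple eapply rec_prefix ].
Ltac rec_more ::= first [ rec_arith | rec_bool | rec_list | rec_fold | rec_seq ].

Local Open Scope classical_set_scope.

Lemma rec_computable (F : baire -> nat -> nat) :
  recursive F -> computable (fun p => Some (F p)).
Proof. by move=> [c Hc]; exists c => p q [<-] n; exact: (Hc p n). Qed.

(** * Closed and perfect sets of sequences *)

Definition agree (T : Type) (n : nat) (x y : nat -> T) : Prop :=
  forall i, i < n -> x i = y i.

Lemma agree_mkseq (T : Type) n (x y : nat -> T) :
  agree n x y <-> mkseq x n = mkseq y n.
Proof.
split=> [xy|e i lti].
  by apply/eq_in_map => i; rewrite mem_iota => /xy.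
by rewrite -(nth_mkseq (x i) x lti) e nth_mkseq.
Qed.

Lemma agreeW (T : Type) m n (x y : nat -> T) : n <= m -> agree m x y -> agree n x y.
Proof. by move=> lenm xy i ltin; apply: xy; exact: leq_trans lenm. Qed.

Lemma agree_sym (T : Type) n (x y : nat -> T) : agree n x y -> agree n y x.
Proof. by move=> xy i /xy. Qed.

Lemma agree_trans (T : Type) n (x y z : nat -> T) :
  agree n x y -> agree n y z -> agree n x z.
Proof. by move=> xy yz i lti; rewrite xy // yz. Qed.

Lemma agree_ex (T : Type) (x y : nat -> T) : x <> y -> exists i, ~ agree i.+1 x y.
Proof.
move=> xy; apply: contrapT => H; apply: xy; apply/funext => i.
apply: contrapT => xyi; apply: H; exists i => /(_ i (leqnn _)); exact: xyi.
Qed.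

(** The use principle: a halting computation asks the oracle finitely many questions. With
    [eval_functional], it is all that the separations need to know about programs. *)
Lemma eval_use p c n m : eval p c n m ->
  exists N, forall q, agree N p q -> eval q c n m.
Proof.
elim: c n m => [||||| f IHf g IHg | f IHf g IHg | f IHf g IHg | f IHf] n m /=;
  try by move=> ->; exists 0.
- by move=> ->; exists n.+1 => q pq; rewrite pq.
- move=> [a [b [/IHf[N1 H1] /IHg[N2 H2] ->]]]; exists (maxn N1 N2) => q pq.
  exists a, b; split=> //; [apply: H1|apply: H2]; apply: agreeW pq;
  by rewrite ?leq_maxl ?leq_maxr.
- move=> [a [/IHg[N1 H1] /IHf[N2 H2]]]; exists (maxn N1 N2) => q pq.
  exists a; split=> //; [apply: H1|apply: H2]; apply: agreeW pq;
  by rewrite ?leq_maxl ?leq_maxr.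
- elim: (Cantor.of_nat n).2 m => [|k IHk] m /=; first exact: IHf.
  move=> [r [/IHk[N1 H1] /IHg[N2 H2]]]; exists (maxn N1 N2) => q pq.
  exists r; split=> //; [apply: H1|apply: H2]; apply: agreeW pq;
  by rewrite ?leq_maxl ?leq_maxr.
- move=> [/IHf[N0 H0] Hm].
  suff [N1 H1] : exists N, forall q, agree N p q ->
      forall i, i < m -> exists r, eval q f (cpair n i) r.+1.
    exists (maxn N0 N1) => q pq; split.
      by apply: H0; apply: agreeW pq; rewrite leq_maxl.
    by apply: H1; apply: agreeW pq; rewrite leq_maxr.
  elim: m Hm {H0} => [|m IHm] Hm; first by exists 0.
  have [|N1 H1] := IHm; first by move=> i /leqW /Hm.
  have [r /IHf[N2 H2]] := Hm m (leqnn _).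
  exists (maxn N1 N2) => q pq i; rewrite ltnS leq_eqVlt => /orP[/eqP->|lti].
    by exists r; apply: H2; apply: agreeW pq; rewrite leq_maxr.
  by apply: H1 lti; apply: agreeW pq; rewrite leq_maxl.
Qed.

Lemma nbhs_ptsE (D : discreteTopologicalType) (x : pts D) (U : set (pts D)) :
  nbhs x U <-> exists n, forall y, agree n x y -> U y.
Proof.
split=> [xU|[n nU]].
  apply: contrapT => nU.
  (* Otherwise points outside [U] that agree with [x] on longer and longer parts would converge to
     [x]. *)
  have H n : exists y, agree n x y /\ ~ U y.
    apply: contrapT => H; apply: nU; exists n => y xy.
    by apply: contrapT => Uy; apply: H; exists y.
  have [y Hy] := choice H.
  have cvy : (y : nat -> pts D) @ \oo --> x.
    apply/cvg_sup => i; apply/cvg_image;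
      first by apply/seteqP; split=> // d _; exists (fun=> d).
    move=> A; rewrite nbhs_principalE => /principal_filterP Ax.
    exists [set z : pts D | A (z i)].
      by exists i.+1 => // k /= leik; rewrite -(Hy k).1.
    by apply/seteqP; split=> [d [z Az <-] //|d Ad]; exists (fun=> d).
  have [N _ HN] := cvy U xU.
  exact: (Hy N).2 (HN N (leqnn N)).
elim: n U nU => [|n IHn] U nU.
  have -> : U = setT by apply/seteqP; split=> // y _; exact: nU.
  exact: filterT.
have -> : U = U `|` ([set y : pts D | agree n x y] `&` [set y : pts D | y n = x n]).
  apply/seteqP; split=> [y|y [//|[xy /= yn]]]; first by left.
  apply: nU => i; rewrite ltnS leq_eqVlt => /orP[/eqP->|]; last exact: xy.
  by rewrite -yn.
apply: (@filterS _ (nbhs x) _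
  ([set y : pts D | agree n x y] `&` [set y : pts D | y n = x n])).
  by move=> y; right.
apply: filterI; first exact: IHn.
apply: (@proj_continuous nat (fun=> D) n x [set x n]).
by rewrite nbhs_principalE; exact/principal_filterP.
Qed.

Lemma closed_ptsP (D : discreteTopologicalType) (C : set (pts D)) :
  closed C <->
  forall x, (forall n, exists2 y, C y & agree n x y) -> C x.
Proof.
split=> [cC x Hx|H x clx].
  apply: cC => U /nbhs_ptsE [n nU]; have [y Cy xy] := Hx n.
  by exists y; split=> //; exact: nU.
apply: H => n.
have [|y [Cy xy]] := clx [set y : pts D | agree n x y].
  by apply/nbhs_ptsE; exists n.
by exists y.
Qed.

Lemma perfect_ptsP (D : discreteTopologicalType) (P : set (pts D)) :
  perfect_set P <-> closed P /\
  forall x n, P x -> exists2 y, P y & y <> x /\ agree n x y.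
Proof.
split=> [[cP PE]|[cP H]]; split=> //.
  move=> x n; rewrite -{1}PE => /(_ [set y : pts D | agree n x y]) [].
    by apply/nbhs_ptsE; exists n.
  by move=> y [/eqP yx Py xy]; exists y.
apply/seteqP; split=> [x /subset_limit_point|x Px].
  by rewrite -(closure_id P).1.
move=> U /nbhs_ptsE [n nU]; have [y Py [yx xy]] := H x n Px.
by exists y; split=> //; [exact/eqP|exact: nU].
Qed.

Lemma countable_enum (T : Type) (A : set T) : A !=set0 -> countable A ->
  exists g : nat -> T, forall a, A a -> exists k, g k = a.
Proof.
move=> [a0 _] /countable_injP [f finj].
have H k : exists y, forall a, A a -> f a = k -> y = a.
  have [[a [Aa fa]]|nH] := pselect (exists a, A a /\ f a = k).
    by exists a => b Ab fb; apply: finj; rewrite ?inE // fa.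
  by exists a0 => b Ab fb; case: nH; exists b.
have [g Hg] := choice H.
by exists g => a Aa; exists (f a); exact: Hg.
Qed.

(* Diagonalization along a Cauchy sequence of points of P, whose k-th step
   leaves a neighbourhood of the k-th point of the enumeration. *)
Lemma perfect_nbhs_uncountable (D : discreteTopologicalType) (P : set (pts D))
    (x : pts D) n :
  perfect_set P -> P x -> ~ countable [set y : pts D | P y /\ agree n x y].
Proof.
move=> /perfect_ptsP [/closed_ptsP cP pP] Px /countable_enum [|g Hg].
  by exists x; split.
have H (ks : nat * (pts D * nat)) : exists s' : pts D * nat, P ks.2.1 ->
    [/\ P s'.1, agree ks.2.2 ks.2.1 s'.1, ks.2.2 < s'.2 &
        ~ agree s'.2 (g ks.1) s'.1].
  case: ks => k [y m] /=; have [Py|?] := pselect (P y); last by exists (y, m).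
  have [z [Pz yz gz]] : exists z, [/\ P z, agree m y z & g k <> z].
    have [e|ne] := pselect (g k = y); last by exists y.
    by have [z Pz [zy yz]] := pP y m Py; exists z; split=> //; rewrite e => /esym.
  have [i ni] := agree_ex gz.
  exists (z, maxn m.+1 i.+1) => _; split=> //=; first by rewrite leq_maxl.
  by move=> gz'; apply: ni; apply: agreeW gz'; rewrite leq_maxr.
have [F HF] := choice H.
pose st := fix st k := if k is k'.+1 then F (k', st k') else (x, n).
have stP k : P (st k).1.
  by elim: k => //= k IH; have [] := HF (k, st k) IH.
have [stA stL] : (forall k, agree (st k).2 (st k).1 (st k.+1).1) /\
                 (forall k, (st k).2 < (st k.+1).2).
  by split=> k; have [] := HF (k, st k) (stP k).
have st_mono k j : k <= j -> (st k).2 <= (st j).2.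
  elim: j => [|j IH]; first by rewrite leqn0 => /eqP->.
  rewrite leq_eqVlt => /orP[/eqP->//|/IH le]; exact: leq_trans (ltnW (stL j)).
have stA2 k j : k <= j -> agree (st k).2 (st k).1 (st j).1.
  elim: j => [|j IH]; first by rewrite leqn0 => /eqP->.
  rewrite leq_eqVlt => /orP[/eqP->//|le]; apply: (agree_trans (IH le)).
  exact: (agreeW (st_mono k j le) (stA j)).
have st_ge k : k <= (st k).2.
  by elim: k => // k IH; exact: leq_ltn_trans IH (stL k).
(* Stage [k] has settled at least [k] digits, so digit [i] is final at stage [i.+1]. *)
pose z : pts D := fun i => (st i.+1).1 i.
have zA k : agree (st k).2 (st k).1 z.
  move=> i lti; rewrite /z; case: (leqP k i.+1) => le; first exact: stA2.
  by rewrite (stA2 _ _ (ltnW le)) // (leq_trans _ (st_ge _)).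
have Pz : P z.
  apply: cP => m; exists (st m).1 => //; apply: agree_sym.
  exact: (agreeW (st_ge m) (zA m)).
have [|k gk] := Hg z; first by split=> //; exact: (zA 0).
have [_ _ _] := HF (k, st k) (stP k); apply => /=.
by rewrite gk; apply: agree_sym; exact: (zA k.+1).
Qed.

Lemma closed_paths (D : discreteTopologicalType) (dig : D -> nat) T :
  closed (paths dig T).
Proof.
apply/closed_ptsP => x Hx n; have [y Ty /agree_mkseq ->] := Hx n; exact: Ty.
Qed.

Lemma chain_limit (T : Type) (t : nat -> seq T) (c : nat -> T) :
  (forall n, t n.+1 = rcons (t n) (c n)) ->
  exists x : nat -> T, forall n, mkseq x (size (t n)) = t n.
Proof.
move=> tS.
have st n : size (t n) = size (t 0) + n.
  by elim: n => [|n IH]; rewrite ?addn0 // tS size_rcons IH addnS.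
pose x i := nth (c 0) (t i.+1) i.
have nt k n i : i < size (t k) -> nth (c 0) (t (k + n)) i = nth (c 0) (t k) i.
  move=> lti; elim: n => [|n IH]; rewrite ?addn0 // addnS tS nth_rcons IH.
  by rewrite ifT // st (leq_trans lti) // st leq_add2l leq_addr.
exists x => n; apply: (@eq_from_nth _ (c 0)); rewrite size_mkseq // => i lti.
rewrite nth_mkseq // /x; have [le|lt] := leqP n i.+1.
  by rewrite -(subnKC le) nt.
by rewrite -[in RHS](subnKC (ltnW lt)) nt // st ltn_addl.
Qed.

Lemma branch_exists (T : Type) (Q : seq T -> Prop) s0 :
  Q s0 -> (forall s, Q s -> exists a, Q (rcons s a)) ->
  exists x : nat -> T, mkseq x (size s0) = s0 /\
    forall n, size s0 <= n -> Q (mkseq x n).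
Proof.
move=> Q0 Qs; have [a0 _] := Qs _ Q0.
have H s : exists a, Q s -> Q (rcons s a).
  by have [/Qs[a]|] := pselect (Q s); [exists a|exists a0].
have [f Hf] := choice H.
pose st n := iter n (fun s => rcons s (f s)) s0.
have Qst n : Q (st n) by elim: n => //= n; exact: Hf.
have sst n : size (st n) = size s0 + n.
  by elim: n => [|n IH]; rewrite ?addn0 //= size_rcons IH addnS.
have [x xst] := @chain_limit _ st (fun n => f (st n)) (fun n => erefl).
exists x; split; first exact: (xst 0).
by move=> n le; rewrite -(subnKC le) -sst xst.
Qed.

(** Having arbitrarily long extensions in [T] passes to one of the two children: bounds for both
    children would give a bound for the parent. *)
Lemma konig (T : pred (seq bool)) :
  (forall s t, prefix s t -> T t -> T s) ->
  (forall n, exists2 s, T s & size s = n) ->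
  exists x : nat -> bool, forall n, T (mkseq x n).
Proof.
move=> Tp Tn.
pose inf s := forall n, exists t, [/\ T t, prefix s t & n <= size t].
have [||x [_ Hx]] := @branch_exists _ inf [::].
- by move=> n; have [t Tt <-] := Tn n; exists t; rewrite prefix0s.
- move=> s infs; apply: contrapT => nb.
  have H b : exists n, forall t, T t -> prefix (rcons s b) t -> size t < n.
    apply: contrapT => H; apply: nb; exists b => n; apply: contrapT => H'.
    apply: H; exists n => t Tt st; rewrite ltnNge; apply/negP => le.
    by apply: H'; exists t.
  have [n0 H0] := H false; have [n1 H1] := H true.
  (* The term [(size s).+1] excludes the extension [t = s], so [t] passes through a child of [s]. *)
  have [t [Tt /prefixP[[|b u] et]]] := infs (maxn (size s).+1 (maxn n0 n1)).
    by rewrite et cats0 geq_max ltnn.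
  rewrite !geq_max => /and3P[_ le0 le1].
  have pb : prefix (rcons s b) t by rewrite et -cat_rcons prefix_prefix.
  case: b et pb => _ pb; first by have := H1 t Tt pb; rewrite ltnNge le1.
  by have := H0 t Tt pb; rewrite ltnNge le0.
- exists x => n; have [t [Tt pt _]] := Hx n (leq0n n) 0; exact: Tp pt Tt.
Qed.

(* A sequence [w] codes a perfect tree: the members are the [s] with
   [w (code s) <> 0], and then [w (code s)] is one plus a pair of codes of
   incomparable members extending [s]. The condition is a conjunction, over all
   pairs (k, j), of a test on [v = w k] and [v' = w j]. *)
Definition perfect_test (b : bool) (k v j v' : nat) : bool :=
  let a := (Cantor.of_nat v.-1).1 in
  let c := (Cantor.of_nat v.-1).2 in
  let d := CodeSeq.decode in
  ((k == 0) ==> ~~ (v == 0)) &&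
  (~~ (v == 0) ==>
     [&& b, prefix (d k) (d a), prefix (d k) (d c),
         ~~ prefix (d a) (d c), ~~ prefix (d c) (d a),
         prefix (d j) (d k) ==> ~~ (v' == 0),
         (j == a) ==> ~~ (v' == 0) & (j == c) ==> ~~ (v' == 0)]).

Definition perfect_code (T : pred (seq nat)) (w : baire) : Prop :=
  forall k j, perfect_test (T (CodeSeq.decode k)) k (w k) j (w j).

Definition members (w : baire) : pred (seq nat) :=
  fun s => ~~ (w (CodeSeq.code s) == 0).

Definition incomparable (s t : seq nat) := ~~ prefix s t /\ ~~ prefix t s.

Lemma perfect_codeP T w : perfect_code T w <->
  [/\ members w [::], forall s, members w s -> T s,
      forall s t, prefix s t -> members w t -> members w s &
      forall s, members w s -> exists a c,
        w (CodeSeq.code s) = (cpair (CodeSeq.code a) (CodeSeq.code c)).+1 /\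
        [/\ members w a, members w c, prefix s a, prefix s c & incomparable a c]].
Proof.
split=> [H|[H0 HT Hp Hs] k j].
  have Hk s j := H (CodeSeq.code s) j.
  have K t : members w t -> forall j, _ :=
    fun wt j => implyP (proj2 (andP (Hk t j))) wt.
  split.
  - by have /andP[] := H 0 0.
  - by move=> s /K /(_ 0) /and5P[]; rewrite CodeSeq.codeK.
  - move=> s t st /K /(_ (CodeSeq.code s)) /and5P[_ _ _ _ /and4P[_ + _ _]].
    by rewrite !CodeSeq.codeK st.
  - move=> s ws; have Ks := K s ws.
    set v := (w (CodeSeq.code s)).-1 in Ks.
    pose a := CodeSeq.decode (Cantor.of_nat v).1.
    pose c := CodeSeq.decode (Cantor.of_nat v).2.
    exists a, c; split.
      rewrite /a /c !CodeSeq.decodeK cpair_of prednK // lt0n; exact: ws.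
    have := Ks (Cantor.of_nat v).1; have := Ks (Cantor.of_nat v).2.
    rewrite !CodeSeq.codeK !eqxx /=.
    move=> /and5P[_ _ _ _ /and4P[_ _ _ wc]] /and5P[_ sa sc ac /and4P[ca _ wa _]].
    by split=> //; rewrite /members CodeSeq.decodeK.
have mE s : (w s != 0) = members w (CodeSeq.decode s).
  by rewrite /members CodeSeq.decodeK.
rewrite /perfect_test !mE; apply/andP; split.
  by apply/implyP => /eqP ->.
apply/implyP => wk; have [a [c [e [wa wc sa sc [ac ca]]]]] := Hs _ wk.
move: e; rewrite CodeSeq.decodeK => ->; rewrite /= of_cpair /= !CodeSeq.codeK.
apply/and5P; split=> //; first exact: HT.
apply/and4P; split=> //; apply/implyP; first by move=> /Hp; exact.
  by move=> /eqP->; rewrite CodeSeq.codeK.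
by move=> /eqP->; rewrite CodeSeq.codeK.
Qed.

Lemma prefix_mkseq (T : eqType) (x : nat -> T) m n :
  m <= n -> prefix (mkseq x m) (mkseq x n).
Proof.
move=> le; rewrite prefixE size_mkseq /mkseq -map_take take_iota.
by rewrite (minn_idPl le).
Qed.

Lemma prefix_mkseqP (T : eqType) (x : nat -> T) s n :
  prefix s (mkseq x n) -> mkseq x (size s) = s.
Proof.
move=> ps; have : prefix (mkseq x (size s)) (mkseq x n).
  by apply: prefix_mkseq; rewrite -(size_mkseq x n) size_prefix.
by move: ps; rewrite !prefixE size_mkseq => /eqP-> /eqP.
Qed.

Lemma prefix_total (T : eqType) (s t u : seq T) :
  prefix s u -> prefix t u -> prefix s t || prefix t s.
Proof.
rewrite !prefixE => /eqP es /eqP et; have [le|le] := leqP (size s) (size t).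
  by rewrite -{1}et take_takel // es eqxx.
by rewrite -{3}es take_takel ?(ltnW le) // et eqxx orbT.
Qed.

Lemma prefix_eq (T : eqType) (s t : seq T) :
  prefix s t -> size s = size t -> s = t.
Proof. by move=> + e; rewrite prefixE e take_size => /eqP. Qed.

Notation npaths := (paths (id : nat -> nat)).

Lemma npathsP (T : pred (seq nat)) (x : pts nat) :
  npaths T x <-> forall n, T (mkseq x n).
Proof. by split=> H n; have := H n; rewrite map_id. Qed.

(** There are no dead ends: of two incomparable extensions of a member, neither can be the member
    itself, so one more letter can always be added. *)
Lemma perfect_code_branch T w s : perfect_code T w -> members w s ->
  exists2 x : pts nat, npaths (members w) x & mkseq x (size s) = s.
Proof.
move=> /perfect_codeP [_ _ wp we] ws.
have [t wt|x [xs Hx]] := @branch_exists _ (members w) s ws.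
  have [a [c [_ [wa wc ta tc [ac _]]]]] := we t wt.
  move/prefixP: ta wa => [[|b u] ea] wa.
    by move: ac; rewrite ea cats0 tc.
  by exists b; apply: wp wa; rewrite ea -cat_rcons prefix_prefix.
exists x => //; apply/npathsP => n.
have [le|/ltnW le] := leqP (size s) n; first exact: Hx.
by apply: (wp _ s) => //; rewrite -xs prefix_mkseq.
Qed.

Lemma perfect_code_perfect T w : perfect_code T w ->
  [/\ npaths (members w) `<=` npaths T, npaths (members w) !=set0 &
      perfect_set (npaths (members w))].
Proof.
move=> pw; have [w0 wT wp we] := (perfect_codeP T w).1 pw; split.
- by move=> x /npathsP wx; apply/npathsP => n; exact: wT.
- by have [x wx _] := perfect_code_branch pw w0; exists x.
apply/perfect_ptsP; split; first exact: closed_paths.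
move=> x n /npathsP wx.
have [a [c [_ [wa wc na nc [ac ca]]]]] := we _ (wx n).
(* Two incomparable words are not both initial segments of [x]; the one that is not leads to a path
   different from [x]. *)
have [b [wb nb bx]] : exists b,
    [/\ members w b, prefix (mkseq x n) b & mkseq x (size b) <> b].
  have [ea|ne] := pselect (mkseq x (size a) = a); last by exists a.
  exists c; split=> // ec.
  have pa : prefix a (mkseq x (maxn (size a) (size c))).
    by rewrite -{1}ea prefix_mkseq ?leq_maxl.
  have pc : prefix c (mkseq x (maxn (size a) (size c))).
    by rewrite -{1}ec prefix_mkseq ?leq_maxr.
  by have := prefix_total pa pc; rewrite (negPf ac) (negPf ca).
have [y wy yb] := perfect_code_branch pw wb.
exists y => //; split; first by move=> e; apply: bx; rewrite -e.
by apply/agree_mkseq; rewrite -yb in nb;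
  rewrite -[in RHS](size_mkseq x n) (prefix_mkseqP nb).
Qed.

Definition cylinder (T : Type) (s : seq T) : set (nat -> T) :=
  [set x | mkseq x (size s) = s].

Lemma perfect_code_uncountable T w s : perfect_code T w -> members w s ->
  ~ countable (npaths T `&` cylinder s : set (pts nat)).
Proof.
move=> pw ws; have [x wx xs] := perfect_code_branch pw ws.
have [sub _ pP] := perfect_code_perfect pw.
move=> cT; apply: (perfect_nbhs_uncountable (n := size s) pP wx).
apply: sub_countable cT; apply: subset_card_le => y [/sub Ty /agree_mkseq xy].
by split=> //; rewrite /cylinder /= -xy.
Qed.

Lemma countable_subsingleton (T : Type) (A : set T) :
  (forall x y, A x -> A y -> x = y) -> countable A.
Proof.
move=> H; apply/countable_injP; exists (fun=> 0) => x y.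
by rewrite !inE => Ax Ay _; exact: H.
Qed.

(** The Cantor-Bendixson kernel: the strings through which uncountably many paths run. If such a
    string did not split within the kernel, its paths would be those leaving the kernel, a countable
    union of countable sets, and at most one more. *)
Lemma perfect_kernel (T : pred (seq nat)) :
  (forall s t, prefix s t -> T t -> T s) ->
  ~ countable (npaths T) ->
  exists2 w, perfect_code T w &
    forall s, members w s <-> ~ countable (npaths T `&` cylinder s : set (pts nat)).
Proof.
move=> Tp unc.
pose K t := `[< ~ countable (npaths T `&` cylinder t : set (pts nat)) >].
have Kp t u : prefix t u -> K u -> K t.
  move=> tu /asboolP Ku; apply/asboolP => cK; apply: Ku.
  apply: sub_countable cK; apply: subset_card_le => x [Tx xu]; split=> //.
  by move: tu; rewrite -xu => /prefix_mkseqP.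
have KT t : K t -> T t.
  move=> /asboolP Kt; apply: contrapT => nT; apply: Kt.
  rewrite (_ : _ `&` _ = set0) //; apply/seteqP; split=> // x [/npathsP Tx xt].
  by apply: nT; rewrite -xt.
have split t : K t -> exists ac : seq nat * seq nat,
    [/\ K ac.1, K ac.2, prefix t ac.1, prefix t ac.2 & incomparable ac.1 ac.2].
  move=> /asboolP Kt; apply: contrapT => H; apply: Kt.
  apply: (@sub_countable _ _ _ (
     (\bigcup_(a in [set a | ~~ K a]) (npaths T `&` cylinder a : set (pts nat))) `|`
     [set x : pts nat | cylinder t x /\ forall n, K (mkseq x n)])).
    apply: subset_card_le => x [Tx xt].
    have [Kx|] := pselect (forall n, K (mkseq x n)); first by right.
    move=> /existsNP [n /negP nK]; left; exists (mkseq x n) => //; split=> //.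
    by rewrite /cylinder /= size_mkseq.
  rewrite -bigcup2E; apply: bigcup_countable => // i _.
  case: i => [|[|i]] /=; last exact: countable0.
    apply: bigcup_countable => // a /= nK; apply: contrapT => Ka.
    by move/asboolP: nK.
  (* Two distinct paths that stay in the kernel have incomparable initial segments extending [t],
     which would be a splitting. *)
  apply: countable_subsingleton => x y [xt Kx] [yt Ky].
  apply: contrapT => /agree_ex [i nxy]; apply: H.
  have tx n : size t <= n -> forall z, cylinder t z -> prefix t (mkseq z n).
    by move=> le z zt; rewrite -[t]zt; exact: prefix_mkseq.
  have nxy' : mkseq x (maxn i.+1 (size t)) <> mkseq y (maxn i.+1 (size t)).
    by move=> /agree_mkseq xy; apply: nxy; apply: agreeW xy; rewrite leq_maxl.
  exists (mkseq x (maxn i.+1 (size t)), mkseq y (maxn i.+1 (size t))).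
  split=> //=; try by apply: tx; rewrite ?leq_maxr.
  split; apply/negP => /prefix_eq; rewrite !size_mkseq => /(_ erefl) // e.
  by apply: nxy'; rewrite e.
have H t : exists ac : seq nat * seq nat, K t ->
    [/\ K ac.1, K ac.2, prefix t ac.1, prefix t ac.2 & incomparable ac.1 ac.2].
  by have [/split[ac Hac]|nK] := pselect (K t); [exists ac|exists ([::], [::])].
have [f Hf] := choice H.
pose w k := let t := CodeSeq.decode k in
  if K t then (cpair (CodeSeq.code (f t).1) (CodeSeq.code (f t).2)).+1 else 0.
have wE t : members w t = K t.
  by rewrite /members /w CodeSeq.codeK; case: (K t).
exists w; last by move=> s; rewrite wE; split=> /asboolP.
apply/perfect_codeP; split.
- rewrite wE; apply/asboolP => cT; apply: unc; apply: sub_countable cT.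
  by apply: subset_card_le => z Tz; split.
- by move=> t; rewrite wE; exact: KT.
- by move=> t u tu; rewrite !wE; exact: Kp.
- move=> t; rewrite wE => Kt; exists (f t).1, (f t).2.
  by rewrite !wE /w CodeSeq.codeK Kt; split=> //; exact: Hf.
Qed.

(** * Reduction of perfect subsets to closed choice *)

Lemma rec_perfect_test E {cE : coded E} (b : baire -> E -> bool)
    (k v j v' : baire -> E -> nat) :
  recursive b -> recursive k -> recursive v -> recursive j -> recursive v' ->
  recursive (fun p e => perfect_test (b p e) (k p e) (v p e) (j p e) (v' p e)).
Proof. by move=> cb ck cv cj cv'; rewrite /perfect_test; rec_auto. Qed.

Lemma closed_name_entries (D : discreteTopologicalType) (dig : D -> nat) p C :
  @closed_name D dig p C -> exists T : pred (seq nat),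
  [/\ tree_over dig T, forall k, (p k == 1) = T (CodeSeq.decode k),
      forall s, p (CodeSeq.code s) = T s & paths dig T = C].
Proof.
move=> [T [tT pT TC]]; exists T; split=> // k.
by rewrite -{1}[k]CodeSeq.decodeK pT; case: (T _).
Qed.

Lemma closed_name_intro (D : discreteTopologicalType) (dig : D -> nat) (p : baire) T
    (C : set (pts D)) :
  tree_over dig T -> (forall s, p (CodeSeq.code s) = T s) -> paths dig T = C ->
  exists2 y : closed_set D, closed_name dig p y & cset y = C.
Proof.
move=> tT pT <-; exists (ClosedSet (@closed_paths D dig T)) => //.
by exists T.
Qed.

Lemma tree_root (D : discreteTopologicalType) (dig : D -> nat) T :
  tree_over dig T -> T [::].
Proof. by move=> [[[s Ts] Tp] _]; apply: Tp Ts; rewrite prefix0s. Qed.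

(** The instance of choice is the set of perfect codes for the given tree. A finite word is kept as
    long as it passes the test for all pairs of entries it contains; a nonempty closed set of codes
    results because the kernel is one of them. *)
Lemma PST_baire_le_C : sW_le PST_baire C_baire.
Proof.
pose F (p : baire) k := let t := CodeSeq.decode k in
  nat_of_bool (all_lt (size t) (fun i => all_lt (size t) (fun j =>
    perfect_test (p i == 1) i (nth 0 t i) j (nth 0 t j)))).
pose G (w : baire) k := nat_of_bool (~~ (w k == 0)).
exists (fun p => Some (F p)), (fun w => Some (G w)).
have cF : recursive F.
  by rewrite /F; rec_auto; simple eapply rec_perfect_test; rec_auto.
have cG : recursive G by rewrite /G; rec_auto.
split; [exact: rec_computable|exact: rec_computable|].
move=> p x /closed_name_entries [T [tT pE pT TC]] unc.
pose S (t : seq nat) := all_lt (size t) (fun i => all_lt (size t) (fun j =>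
    perfect_test (T (CodeSeq.decode i)) i (nth 0 t i) j (nth 0 t j))).
have SE : npaths S = [set w : pts nat | perfect_code T w].
  apply/seteqP; split=> w /=.
    move=> /npathsP H i j; have /all_ltP := H (maxn i j).+1.
    rewrite size_mkseq => /(_ i); rewrite ltnS leq_maxl => /(_ isT).
    move=> /all_ltP /(_ j); rewrite ltnS leq_maxr => /(_ isT).
    by rewrite !nth_mkseq // ltnS ?leq_maxl ?leq_maxr.
  move=> H; apply/npathsP => n; apply/all_ltP => i lti; apply/all_ltP => j ltj.
  by rewrite size_mkseq in lti ltj; rewrite !nth_mkseq //; exact: H.
have [||y ny yE] := closed_name_intro (p := F p) (T := S) _ _ SE.
- split; [split|by move=> s _; exists s; rewrite map_id].
    by exists [::].
  move=> s t /prefixP[u ->] /all_ltP H; apply/all_ltP => i lti.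
  have lt k : k < size s -> k < size (s ++ u).
    by move=> /leq_trans; apply; rewrite size_cat leq_addr.
  apply/all_ltP => j ltj; have /all_ltP /(_ j (lt _ ltj)) := H i (lt _ lti).
  by rewrite !nth_cat lti ltj.
- move=> s; rewrite /F CodeSeq.codeK /S; congr nat_of_bool.
  by apply/all_ltP/all_ltP => H i /H /all_ltP H'; apply/all_ltP => j /H';
    rewrite pE.
exists (F p), y; split=> //.
  have [|w wT _] := @perfect_kernel T tT.1.2; first by rewrite TC.
  by exists w; rewrite /= yE.
move=> w z <- /=; rewrite yE /= => wT.
have [sub ne pP] := perfect_code_perfect wT.
have [w0 _ wp _] := (perfect_codeP T w).1 wT.
have [||Q nQ QE] := closed_name_intro (p := G w) (T := members w) _ _
  (erefl (npaths (members w))).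
- split; [split|by move=> s _; exists s; rewrite map_id].
    by exists [::].
  exact: wp.
- by [].
by exists (G w), Q; split=> //; rewrite QE; split=> //; rewrite -TC.
Qed.

(** * Baire space inside Cantor space *)

(* [enc s] is the word 1^(s_0) 0 1^(s_1) 0 ... ; the second component of
   [dec_run] is the length of the incomplete last block of ones. *)
Definition enc (s : seq nat) : seq nat :=
  foldr (fun n t => nseq n 1 ++ 0 :: t) [::] s.

Definition dec_step (ac : seq nat * nat) (x : nat) : seq nat * nat :=
  if x == 0 then (ac.1 ++ [:: ac.2], 0) else (ac.1, ac.2.+1).

Definition dec_run (u : seq nat) : seq nat * nat := foldl dec_step ([::], 0) u.

Definition dec (u : seq nat) : seq nat := (dec_run u).1.

Definition binary (u : seq nat) : bool := all (fun k => k <= 1) u.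

(** The incomplete last block is ignored. Hence the paths are the codes of the paths of [T] and, in
    addition, the members of [T] followed by ones for ever, which are countably many. *)
Definition cantorize (T : pred (seq nat)) : pred (seq nat) :=
  fun u => binary u && T (dec u).

Lemma binaryP s : binary s <-> exists u : seq bool, s = map nat_of_bool u.
Proof.
split=> [bs|[u ->]]; last by apply/allP => _ /mapP[[] _ ->].
exists (map (fun k => k == 1) s).
rewrite -map_comp -[LHS]map_id; apply/eq_in_map => k /(allP bs) /=.
by case: k => [|[]].
Qed.

Lemma rec_enc E {cE : coded E} (s : baire -> E -> seq nat) :
  recursive s -> recursive (fun p e => enc (s p e)).
Proof. by move=> cs; rewrite /enc; rec_auto. Qed.

Lemma rec_dec E {cE : coded E} (s : baire -> E -> seq nat) :
  recursive s -> recursive (fun p e => dec (s p e)).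
Proof. by move=> cs; rewrite /dec /dec_run /dec_step; rec_auto. Qed.

Lemma rec_binary E {cE : coded E} (s : baire -> E -> seq nat) :
  recursive s -> recursive (fun p e => binary (s p e)).
Proof. by move=> cs; rewrite /binary; rec_auto. Qed.

Lemma enc_cat s t : enc (s ++ t) = enc s ++ enc t.
Proof. by elim: s => //= n s ->; rewrite -catA. Qed.

Lemma enc_prefix s t : prefix s t -> prefix (enc s) (enc t).
Proof. by move=> /prefixP[u ->]; rewrite enc_cat prefix_prefix. Qed.

Lemma size_enc s : size s <= size (enc s).
Proof.
elim: s => //= n s IH; rewrite size_cat /= size_nseq addnS ltnS.
exact: leq_trans (leq_addl _ _).
Qed.

Lemma binary_enc s : binary (enc s).
Proof.
elim: s => //= n s IH; rewrite /binary all_cat /= [all _ (enc s)]IH andbT.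
by rewrite all_nseq orbT.
Qed.

Lemma dec_run_ones s c k : foldl dec_step (s, c) (nseq k 1) = (s, c + k).
Proof. by elim: k c => [|k IH] c /=; rewrite ?addn0 // IH addSnnS. Qed.

Lemma dec_run_enc s k : dec_run (enc s ++ nseq k 1) = (s, k).
Proof.
rewrite /dec_run foldl_cat; have -> : foldl dec_step ([::], 0) (enc s) = (s, 0).
  elim/last_ind: s => // s n IH; rewrite -cats1 enc_cat foldl_cat IH /=.
  by rewrite foldl_cat dec_run_ones.
exact: dec_run_ones.
Qed.

Lemma dec_enc s : dec (enc s) = s.
Proof. by rewrite /dec -[enc s]cats0 (dec_run_enc s 0). Qed.

Lemma dec_prefix u v : prefix u v -> prefix (dec u) (dec v).
Proof.
move=> /prefixP[t ->]; rewrite /dec /dec_run foldl_cat.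
elim: t (foldl _ _ u) => [|x t IH] ac /=; first exact: prefix_refl.
apply: prefix_trans (IH _); rewrite /dec_step.
by case: eqP => _ /=; rewrite ?prefix_refl // prefix_prefix.
Qed.

Lemma dec_runK u : binary u -> u = enc (dec u) ++ nseq (dec_run u).2 1.
Proof.
elim/last_ind: u => // u x IH; rewrite /binary all_rcons => /andP[x1 /IH eu].
rewrite /dec /dec_run foldl_rcons -/(dec_run u) {1}eu {IH}.
rewrite /dec_step; case: x x1 => [|[|//]] _ /=.
  by rewrite enc_cat cats0 rcons_cat -cats1.
rewrite -cats1 -catA; congr (_ ++ _).
by elim: (dec_run u).2 => //= k ->.
Qed.

Definition word (x : pts bool) n : seq nat := map nat_of_bool (mkseq x n).

Lemma size_word x n : size (word x n) = n.
Proof. by rewrite size_map size_mkseq. Qed.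

Lemma binary_word x n : binary (word x n).
Proof. by apply/binaryP; exists (mkseq x n). Qed.

Lemma nth_word d x n i : i < n -> nth d (word x n) i = x i.
Proof. by move=> lt; rewrite (nth_map false) ?size_mkseq // nth_mkseq. Qed.

Lemma prefix_word x m n : m <= n -> prefix (word x m) (word x n).
Proof.
move=> le; rewrite prefixE size_word /word -map_take /mkseq -map_take take_iota.
by rewrite (minn_idPl le).
Qed.

Lemma agree_word n x y : agree n x y <-> word x n = word y n.
Proof.
rewrite agree_mkseq; split; last exact: (inj_map nat_of_bool_inj).
exact: (congr1 (map nat_of_bool)).
Qed.

(** Every block contains its final zero, so [i.+1] blocks are long enough to fix bit [i]. *)
Definition enc_path (w : baire) : pts bool :=
  fun i => nth 0 (enc (mkseq w i.+1)) i == 1.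

(** The default 1 continues [enc s] by ones for ever. *)
Definition stuck_path (s : seq nat) : pts bool := fun i => nth 1 (enc s) i == 1.

Lemma word_enc_path w m n : n <= size (enc (mkseq w m)) ->
  word (enc_path w) n = take n (enc (mkseq w m)).
Proof.
move=> le; apply: (@eq_from_nth _ 0); rewrite size_word ?size_takel // => i lti.
rewrite nth_word // nth_take // /enc_path.
have [u e] : exists u, enc (mkseq w (maxn m i.+1)) = enc (mkseq w m) ++ u.
  by apply/prefixP; apply: enc_prefix; rewrite prefix_mkseq ?leq_maxl.
have [v e'] : exists v, enc (mkseq w (maxn m i.+1)) = enc (mkseq w i.+1) ++ v.
  by apply/prefixP; apply: enc_prefix; rewrite prefix_mkseq ?leq_maxr.
have lt' : i < size (enc (mkseq w i.+1)).
  by apply: leq_trans (size_enc _); rewrite size_mkseq.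
have := congr1 (fun s => nth 0 s i) e; rewrite e' !nth_cat lt' (leq_trans lti le).
move=> ->; set x := nth _ _ _.
have : x <= 1.
  have /allP := binary_enc (mkseq w m); apply; apply: mem_nth.
  exact: leq_trans le.
by case: x => [|[]].
Qed.

Lemma prefix_word_enc w n : prefix (word (enc_path w) n) (enc (mkseq w n)).
Proof.
rewrite (@word_enc_path _ n) ?prefix_take //.
by rewrite (leq_trans _ (size_enc _)) // size_mkseq.
Qed.

Lemma word_enc w m :
  word (enc_path w) (size (enc (mkseq w m))) = enc (mkseq w m).
Proof. by rewrite (@word_enc_path _ m) ?take_size. Qed.

Lemma dec_word_enc w n : exists2 m, m <= n & dec (word (enc_path w) n) = mkseq w m.
Proof.
have := dec_prefix (prefix_word_enc w n); rewrite dec_enc => p.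
exists (size (dec (word (enc_path w) n))).
  by have := size_prefix p; rewrite size_mkseq.
by rewrite (prefix_mkseqP p).
Qed.

(** If infinitely many blocks are completed, the decoded words converge to a point coded by [x].
    Otherwise only ones follow after the last completed block. *)
Lemma enc_path_cases (x : pts bool) :
  (exists w, x = enc_path w) \/ (exists s, x = stuck_path s).
Proof.
have [H|H] := pselect (forall k, exists n, k < size (dec (word x n))).
  left; have [f Hf] := choice H.
  pose w k := nth 0 (dec (word x (f k))) k.
  have wE n : mkseq w (size (dec (word x n))) = dec (word x n).
    apply: (@eq_from_nth _ 0); rewrite size_mkseq // => i lti.
    rewrite nth_mkseq // /w; set m := f i.
    have [le|/ltnW le] := leqP m n.
      have /dec_prefix /prefixP[u ->] := prefix_word x le.
      by rewrite nth_cat Hf.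
    have /dec_prefix /prefixP[u ->] := prefix_word x le.
    by rewrite nth_cat lti.
  exists w; apply/funext => i; apply: nat_of_bool_inj.
  have e : word x (f i) = enc (mkseq w (size (dec (word x (f i))))) ++
       nseq (dec_run (word x (f i))).2 1.
    by rewrite wE; exact/dec_runK/binary_word.
  have lei : i < size (enc (mkseq w (size (dec (word x (f i)))))).
    by rewrite (leq_trans _ (size_enc _)) // size_mkseq.
  have lti : i < f i.
    by rewrite -(size_word x (f i)) e size_cat ltn_addr.
  rewrite -(nth_word 0 x lti) e nth_cat lei -word_enc nth_word //.
right; move/existsNP: H => [k Hk].
have bd n : size (dec (word x n)) <= k.
  by rewrite leqNgt; apply/negP => lt; apply: Hk; exists n.
(* At stage [N] the decoded word has its maximal length, so it never changes afterwards. *)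
have [N HN] : exists N, forall n, size (dec (word x n)) <= size (dec (word x N)).
  pose Q m := `[< exists n, size (dec (word x n)) = m >].
  have [||m /asboolP[N eN] mmax] := @ex_maxnP Q k.
  - by exists (size (dec (word x 0))); apply/asboolP; exists 0.
  - by move=> m /asboolP[n <-]; exact: bd.
  - by exists N => n; rewrite eN; apply: mmax; apply/asboolP; exists n.
exists (dec (word x N)); apply/funext => i.
pose M := maxn N i.+1.
have eM : dec (word x M) = dec (word x N).
  have p := dec_prefix (prefix_word x (leq_maxl N i.+1)).
  apply/esym/prefix_eq => //; apply/eqP; rewrite eqn_leq HN andbT.
  by rewrite size_prefix.
have lt : i < M by rewrite leq_maxr.
have e := dec_runK (binary_word x M); rewrite eM in e.
have -> : x i = (nth 1 (word x M) i == 1) by rewrite nth_word //; case: (x i).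
rewrite e nth_cat /stuck_path; case: ifP => // /negbT; rewrite -leqNgt => le.
by rewrite nth_nseq [in RHS]nth_default //; case: ifP.
Qed.

Lemma enc_path_inj w w' : enc_path w = enc_path w' -> w = w'.
Proof.
move=> e; apply/funext => i.
have := word_enc w i.+1; rewrite e => ew.
have [m _] := dec_word_enc w' (size (enc (mkseq w i.+1))).
rewrite ew dec_enc => e'.
have em : m = i.+1 by have := congr1 size e'; rewrite !size_mkseq.
by have := congr1 (fun s => nth 0 s i) e'; rewrite em !nth_mkseq.
Qed.

Lemma agree_enc_path w w' n :
  agree (size (enc (mkseq w n))) (enc_path w) (enc_path w') -> agree n w w'.
Proof.
move=> /agree_word; rewrite word_enc => e.
have [m _] := dec_word_enc w' (size (enc (mkseq w n))).
rewrite -e dec_enc => e'.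
have em : m = n by have := congr1 size e'; rewrite !size_mkseq.
by apply/agree_mkseq; rewrite e' em.
Qed.

(* A perfect set is not covered by the countably many stuck paths. *)
Lemma perfect_enc_path (P : set (pts bool)) (x : pts bool) n :
  perfect_set P -> P x ->
  exists w, [/\ P (enc_path w), agree n x (enc_path w) & enc_path w <> x].
Proof.
move=> pP Px; apply: contrapT => H.
apply: (perfect_nbhs_uncountable (n := n) pP Px).
apply: (@sub_countable _ _ _ (\bigcup_(o in [set: option (seq nat)])
   [set if o is Some s then stuck_path s else x])).
  apply: subset_card_le => y [Py xy].
  have [e|ne] := pselect (y = x); first by exists None.
  have [[w ew]|[s es]] := enc_path_cases y; last by exists (Some s).
  by case: H; exists w; rewrite -ew.
by apply: bigcup_countable => // o _; exact: countable1.
Qed.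

(** * Equivalence of the two perfect set problems *)

Lemma word_pathsP (U : pred (seq nat)) (x : pts bool) :
  paths nat_of_bool U x <-> forall n, U (word x n).
Proof. by []. Qed.

Lemma cantorize_enc_path (T : pred (seq nat)) (w : pts nat) :
  (forall s t, prefix s t -> T t -> T s) ->
  paths nat_of_bool (cantorize T) (enc_path w) <-> npaths T w.
Proof.
move=> Tp; split=> [/word_pathsP H|/npathsP Tw n].
  apply/npathsP => n; have := H (size (enc (mkseq w n))).
  by rewrite word_enc /cantorize dec_enc => /andP[].
rewrite /cantorize binary_word; have [m _ ->] := dec_word_enc w n; exact: Tw.
Qed.

Lemma tree_cantorize (T : pred (seq nat)) :
  tree T -> tree_over nat_of_bool (cantorize T).
Proof.
move=> [[s0 Ts0] Tp]; split; [split|by move=> s /andP[/binaryP]].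
  by exists [::]; apply: Tp Ts0; rewrite prefix0s.
move=> s t st /andP[bt Tt]; rewrite /cantorize (Tp _ _ (dec_prefix st) Tt) andbT.
by move/prefixP: st bt => [u ->]; rewrite /binary all_cat => /andP[].
Qed.

Lemma cantorize_uncountable (T : pred (seq nat)) :
  (forall s t, prefix s t -> T t -> T s) ->
  ~ countable (npaths T) -> ~ countable (paths nat_of_bool (cantorize T)).
Proof.
move=> Tp unc /countable_injP [f finj]; apply: unc; apply/countable_injP.
exists (f \o enc_path) => w w'; rewrite !inE => Tw Tw' e.
by apply: enc_path_inj; apply: finj; rewrite // inE; exact/cantorize_enc_path.
Qed.

(** A binary tree names a closed set in both spaces, so the instance is passed on unchanged. A tree
    for the answer may have dead ends that are not binary; these are cut off. *)
Lemma PST_cantor_le_baire : sW_le PST_cantor PST_baire.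
Proof.
pose G (q : baire) k := if binary (CodeSeq.decode k) then q k else 0.
exists Some, (fun q => Some (G q)).
have cG : recursive G by rewrite /G; rec_auto; simple eapply rec_binary; rec_auto.
split; [by exists Oracle => p q [->]|exact: rec_computable|].
move=> p x /closed_name_entries [T [tT _ pT TC]] unc.
have emb (y : pts bool) : npaths T (nat_of_bool \o y) <-> paths nat_of_bool T y.
  by split=> H n; move: (H n); rewrite /mkseq -!map_comp.
have nT : tree_over (id : nat -> nat) T.
  by split; [exact: tT.1|move=> s _; exists s; rewrite map_id].
have [y ny yE] := closed_name_intro nT pT erefl.
exists p, y; split=> //=.
  rewrite yE => cT; apply: unc; rewrite -TC.
  move/countable_injP: cT => [f finj]; apply/countable_injP.
  exists (fun z => f (nat_of_bool \o z)) => z z'; rewrite !inE => Tz Tz' e.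
  have e' : nat_of_bool \o z = nat_of_bool \o z'.
    by apply: finj => //; rewrite inE; exact/emb.
  by apply/funext => i; apply: nat_of_bool_inj; have := congr1 (@^~ i) e'.
move=> q z /closed_name_entries [U [tU _ qU UE]] [Uy [x0 Px0] /perfect_ptsP [cP pP]].
have pull (v : pts nat) : npaths U v -> exists2 v' : pts bool,
    v = nat_of_bool \o v' & paths nat_of_bool T v'.
  rewrite UE => /Uy; rewrite yE => Tv.
  have b i : v i <= 1.
    have /npathsP Tv' := Tv; have [u eu] := tT.2 _ (Tv' i.+1).
    have : binary (mkseq v i.+1) by apply/binaryP; exists u.
    by move=> /allP; apply; apply/mapP; exists i => //; rewrite mem_iota add0n ltnSn.
  exists (fun i => v i == 1); last first.
    apply/emb; rewrite (_ : _ \o _ = v) //; apply/funext => i /=.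
    by have := b i; case: (v i) => [|[]].
  by apply/funext => i /=; have := b i; case: (v i) => [|[]].
pose V s := binary s && U s.
have VE (v : pts bool) : paths nat_of_bool V v <-> npaths U (nat_of_bool \o v).
  split=> H n; have := H n; rewrite /V /mkseq -!map_comp.
    by case/andP.
  by move=> ->; rewrite andbT; apply/binaryP; exists (mkseq v n); rewrite -map_comp.
have [||Q nQ QE] := closed_name_intro (dig := nat_of_bool) (p := G q) (T := V)
  _ _ erefl.
- split; [split|by move=> s /andP[/binaryP]].
    by exists [::]; rewrite /V (tree_root tU).
  move=> s t st /andP[bt Ut]; rewrite /V (tU.1.2 _ _ st Ut) andbT.
  by move/prefixP: st bt => [u ->]; rewrite /binary all_cat => /andP[].
- by move=> s; rewrite /G CodeSeq.codeK qU /V; case: (binary s).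
exists (G q), Q; split=> //; rewrite QE; split.
- move=> v /VE Uv; rewrite -TC; have [v' e Tv'] := pull _ Uv.
  rewrite (_ : v = v') //; apply/funext => i; apply: nat_of_bool_inj.
  by have := congr1 (@^~ i) e.
- rewrite -UE in Px0; have [v e _] := pull _ Px0; exists v; apply/VE.
  by rewrite -e.
- apply/perfect_ptsP; split; first exact: closed_paths.
  move=> v n /VE Uv; have Pv : cset z (nat_of_bool \o v) by rewrite -UE.
  have [t Pt [tv vt]] := pP _ n Pv; rewrite -UE in Pt.
  have [t' e _] := pull _ Pt; exists t'; first by apply/VE; rewrite -e.
  split=> [e'|i lti]; first by apply: tv; rewrite e e'.
  by apply: nat_of_bool_inj; have := vt i lti; rewrite e.
Qed.

(** The answer is pulled back along [enc]. By [perfect_enc_path], coded points are dense in it,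
    which makes the pullback nonempty and free of isolated points. *)
Lemma PST_baire_le_cantor : sW_le PST_baire PST_cantor.
Proof.
pose F (p : baire) k := let u := CodeSeq.decode k in
  if binary u then p (CodeSeq.code (dec u)) else 0.
pose G (q : baire) k := q (CodeSeq.code (enc (CodeSeq.decode k))).
exists (fun p => Some (F p)), (fun q => Some (G q)).
have cF : recursive F.
  rewrite /F; rec_auto; first by simple eapply rec_binary; rec_auto.
  by simple eapply rec_dec; rec_auto.
have cG : recursive G by rewrite /G; rec_auto; simple eapply rec_enc; rec_auto.
split; [exact: rec_computable|exact: rec_computable|].
move=> p x /closed_name_entries [T [tT _ pT TC]] unc.
have [Tt Tp] : tree T /\ forall s t, prefix s t -> T t -> T s.
  by split; [exact: tT.1|exact: tT.1.2].
have [|y ny yE] := closed_name_intro (p := F p) (tree_cantorize Tt) _ erefl.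
  move=> u; rewrite /F CodeSeq.codeK /cantorize pT.
  by case: (binary u).
exists (F p), y; split=> //=.
  by rewrite yE; apply: cantorize_uncountable => //; rewrite TC.
move=> q z /closed_name_entries [U [tU _ qU UE]] [Uy [x0 Px0] pP].
pose V s := U (enc s).
have VE (w : pts nat) : npaths V w <-> cset z (enc_path w).
  rewrite -UE word_pathsP npathsP; split=> H n.
    by apply: tU.1.2 (prefix_word_enc w n) _; exact: H.
  by have := H (size (enc (mkseq w n))); rewrite word_enc.
have [||Q nQ QE] := closed_name_intro (p := G q) (T := V) (dig := id) _ _ erefl.
- split; [split|by move=> s _; exists s; rewrite map_id].
    by exists [::]; exact: tree_root tU.
  by move=> s t st; apply: tU.1.2; exact: enc_prefix.
- by move=> s; rewrite /G CodeSeq.codeK qU.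
exists (G q), Q; split=> //; rewrite QE; split.
- move=> w /VE /Uy; rewrite yE -TC; exact: (cantorize_enc_path _ _).1.
- by have [w [Pw _ _]] := perfect_enc_path 0 pP Px0; exists w; apply/VE.
- apply/perfect_ptsP; split; first exact: closed_paths.
  move=> w n /VE Pw.
  have [w' [Pw' /agree_enc_path ww' ne]] :=
    perfect_enc_path (size (enc (mkseq w n))) pP Pw.
  by exists w'; [exact/VE|split=> // e; apply: ne; rewrite e].
Qed.

(** * Unique choice from perfect subsets of Cantor space *)

(* Each entry of a path is known up to a bit: a path becomes a compact perfect
   set, so that its entries can be recovered by compactness from a tree with dead
   ends. *)
Definition blowup (T : pred (seq nat)) : pred (seq nat) :=
  fun s => T (map half s).

Lemma blowup_paths (T : pred (seq nat)) (w : pts nat) :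
  npaths (blowup T) w <-> npaths T (half \o w).
Proof.
by rewrite !npathsP; split=> H n; have := H n; rewrite /blowup /mkseq -map_comp.
Qed.

Lemma blowup_prefix (T : pred (seq nat)) :
  (forall s t, prefix s t -> T t -> T s) ->
  forall s t, prefix s t -> blowup T t -> blowup T s.
Proof.
move=> Tp s t /prefixP[u ->]; rewrite /blowup map_cat; apply: Tp.
exact: prefix_prefix.
Qed.

Lemma uncountable_half (A : set (pts nat)) (v : pts nat) :
  (forall w : pts nat, half \o w = v -> A w) -> ~ countable A.
Proof.
move=> Av /countable_enum [|g Hg].
  by exists (double \o v); apply: Av; apply/funext => i /=; rewrite doubleK.
(* Cantor's diagonal in the lowest bits, which halving leaves free. *)
pose w : pts nat := fun i => ~~ odd (g i i) + (v i).*2.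
have [|k gk] := Hg w.
  by apply: Av; apply/funext => i /=; rewrite half_bit_double.
have := congr1 (fun x : pts nat => odd (x k)) gk.
by rewrite /w oddD odd_double addbF oddb; case: (odd _).
Qed.

Lemma rec_half E {cE : coded E} (f : baire -> E -> nat) :
  recursive f -> recursive (fun p e => (f p e)./2).
Proof.
move=> cf; apply: (@rec_ext _ _ _ _ (fun p e =>
  (iter (f p e) (fun x : nat * nat => (x.2, x.1.+1)) (0, 0)).1)).
  move=> p e; suff -> : forall n,
    iter n (fun x : nat * nat => (x.2, x.1.+1)) (0, 0) = (n./2, uphalf n) by [].
  by elim=> //= n ->.
rec_auto.
Qed.

Lemma code_binary_lt (u : seq nat) : binary u -> CodeSeq.code u < 4 ^ size u.
Proof.
elim: u => // x u IH /andP[x1 /IH lt]; rewrite code_cons /= expnS.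
apply: leq_ltn_trans (_ : 2 * (CodeSeq.code u).*2.+1 < _).
  by rewrite leq_mul2r -{2}(expn1 2) leq_exp2l // x1 orbT.
apply: leq_trans (_ : 4 * (CodeSeq.code u).+1 <= _); last by rewrite leq_mul2l.
by rewrite !mulnS -mul2n (mulnA 2 2) ltn_add2r.
Qed.

Lemma size_enc_le (w w' : baire) n : (forall i, w i <= w' i) ->
  size (enc (mkseq w n)) <= size (enc (mkseq w' n)).
Proof.
move=> le; elim: n => // n IH; rewrite /mkseq -addn1 !iotaD !map_cat !enc_cat.
by rewrite !size_cat leq_add //= !size_nseq leq_add2r.
Qed.

(** Dead ends of the answer tree cannot be recognised, so the search waits for a level at which all
    words, dead or not, agree on half of entry [i]. The bound [4 ^ n] exceeds the codes of all
    binary words of length [n]. *)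
Definition settles (q : baire) (i n k : nat) : bool :=
  all_lt (4 ^ n) (fun c => let u := CodeSeq.decode c in
    [&& size u == n, binary u & ~~ (q c == 0)] ==>
    (i < size (dec u)) && ((nth 0 (dec u) i)./2 == k)).

Lemma rec_settles E {cE : coded E} (i n k : baire -> E -> nat) :
  recursive i -> recursive n -> recursive k ->
  recursive (fun p e => settles p (i p e) (n p e) (k p e)).
Proof.
move=> ci cn ck; rewrite /settles; rec_auto.
- by simple eapply rec_binary; rec_auto.
- by simple eapply rec_dec; rec_auto.
- by simple eapply rec_half; rec_auto; simple eapply rec_dec; rec_auto.
Qed.

(** [F] is undefined as soon as one of the searches fails, which is why reductions using it are
    partial. *)
Lemma computable_search (P : baire -> nat -> nat -> bool)
    (f : baire -> nat -> nat) :
  recursive (fun p (e : nat * nat) => P p e.1 e.2) ->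
  recursive f ->
  exists F : baire -> option baire, computable F /\
    forall p, (forall i, exists m, P p i m) ->
    exists q, F p = Some q /\ forall i, exists2 m, P p i m & q i = f p m.
Proof.
move=> /rec_neg [c Hc] [d Hd].
pose F (p : baire) := if pselect (forall i, exists m, P p i m) is left H
  then Some (fun i => f p (ex_minn (H i))) else None.
exists F; split; last first.
  move=> p H; rewrite /F; case: pselect => // H'; eexists; split; first by [].
  by move=> i /=; case: ex_minnP => m Pm _; exists m.
exists (Comp d (Min c)) => p q; rewrite /F; case: pselect => // H [<-] n.
case: ex_minnP => m Pm mmin /=; exists m; split; last exact: Hd.
have Hi i : eval p c (cpair n i) (nat_of_bool (~~ P p n i)) by exact: (Hc p (n, i)).
split; first by have := Hi m; rewrite Pm.
move=> i lti; exists 0; have := Hi i; case: (boolP (P p n i)) => // /mmin.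
by rewrite leqNgt lti.
Qed.

Lemma UC_le_PST_cantor : sW_le UC_baire PST_cantor.
Proof.
pose F (p : baire) k := let u := CodeSeq.decode k in
  if binary u then p (CodeSeq.code (map half (dec u))) else 0.
have cF : recursive F.
  rewrite /F; rec_auto; first by simple eapply rec_binary; rec_auto.
    by simple eapply rec_half; rec_auto.
  by simple eapply rec_dec; rec_auto.
have cS : recursive (fun q (e : nat * nat) =>
    settles q e.1 (Cantor.of_nat e.2).1 (Cantor.of_nat e.2).2).
  by simple eapply rec_settles; rec_auto.
have cV : recursive (fun (_ : baire) (m : nat) => (Cantor.of_nat m).2) by rec_auto.
have [G [cG HG]] := computable_search (P := fun q i m =>
  settles q i (Cantor.of_nat m).1 (Cantor.of_nat m).2) cS cV.
exists (fun p => Some (F p)), G; split=> //; first exact: rec_computable.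
move=> p x /closed_name_entries [T [tT _ pT TC]] [v xv].
have Tp : forall s t, prefix s t -> T t -> T s by exact: tT.1.2.
have Bp := blowup_prefix Tp.
have tB : tree (blowup T) by split=> //; exists [::]; exact: tree_root tT.
have BE (w : pts nat) : npaths (blowup T) w <-> half \o w = v.
  by rewrite blowup_paths TC xv.
have [|y ny yE] := closed_name_intro (p := F p) (tree_cantorize tB) _ erefl.
  move=> u; rewrite /F CodeSeq.codeK /cantorize pT.
  by case: (binary u).
exists (F p), y; split=> //=.
  rewrite yE; apply: cantorize_uncountable => //.
  by apply: (@uncountable_half _ v) => w /BE.
move=> q P /closed_name_entries [U [tU _ qU UE]] [Py [x0 Px0] pP].
(* An initial segment of a point of [P] is also one of a coded point of [P], whose entries halve to
   those of [v]. *)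
have good (z : pts bool) n i : cset P z -> i < size (dec (word z n)) ->
    (nth 0 (dec (word z n)) i)./2 = v i.
  move=> Pz; have [w [Pw /agree_word -> _]] := perfect_enc_path n pP Pz.
  have [m _ ->] := dec_word_enc w n; rewrite size_mkseq => lti.
  rewrite nth_mkseq //; suff <- : half \o w = v by [].
  by apply/BE/(cantorize_enc_path _ Bp); rewrite -yE; exact: Py.
(* Entry [j] of a coded point is at most [(v j).*2.+1], so [N i] bits complete at least [i.+1]
   blocks. *)
pose N i := size (enc (mkseq (fun j => (v j).*2.+1) i.+1)).
have long (z : pts bool) i : cset P z -> i < size (dec (word z (N i))).
  move=> Pz; have [w [Pw /agree_word -> _]] := perfect_enc_path (N i) pP Pz.
  have wv : half \o w = v.
    by apply/BE/(cantorize_enc_path _ Bp); rewrite -yE; exact: Py.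
  have le : size (enc (mkseq w i.+1)) <= N i.
    apply: size_enc_le => j; rewrite -wv /= -{1}(odd_double_half (w j)).
    by case: (odd _); rewrite // add0n leqnSn.
  have /dec_prefix /size_prefix := prefix_word (enc_path w) le.
  by rewrite word_enc dec_enc size_mkseq.
have Uname c : ~~ (q c == 0) = U (CodeSeq.decode c).
  by rewrite -{1}[c]CodeSeq.decodeK qU; case: (U _).
(* If no level settles entry [i], the words with a missing or wrong entry have an infinite path. It
   lies in [P], and its first [N i] bits decode correctly. *)
have ex i : exists n, settles q i n (v i).
  pose bad (s : seq bool) := let u := map nat_of_bool s in
    U u && ~~ ((i < size (dec u)) && ((nth 0 (dec u) i)./2 == v i)).
  apply: contrapT => H.
  have [||z Hz] := @konig bad.
  - move=> s t /prefixP[s' ->]; rewrite /bad map_cat => /andP[Ut bt].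
    rewrite (tU.1.2 _ _ (prefix_prefix _ _) Ut) /=.
    apply: contra bt => /andP[lt e].
    have /dec_prefix /prefixP[u' ->] :=
      prefix_prefix (map nat_of_bool s) (map nat_of_bool s').
    by rewrite size_cat nth_cat lt ltn_addr.
  - move=> n; apply: contrapT => nb; apply: H; exists n.
    apply/all_ltP => c _; apply/implyP => /and3P[/eqP su /binaryP[s es] qc].
    apply/negPn/negP => bu; apply: nb; exists s.
      by rewrite /bad -es bu andbT -Uname.
    by rewrite -su es size_map.
  have Pz : cset P z by rewrite -UE => n; have /andP[] := Hz n.
  have /andP[_ /negP] := Hz (N i); apply.
  by rewrite -/(word z (N i)) long // good ?long // eqxx.
have [|g [gE gP]] := HG q.
  by move=> i; have [n Hn] := ex i; exists (cpair n (v i)); rewrite of_cpair.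
exists g, v; split=> //; last by rewrite /= xv.
apply/funext => i; have [m + ->] := gP i.
set n := (_).1; set k := (_).2; move=> /all_ltP st.
(* The agreement found by the search is not vacuous: the point [x0] of [P] provides a word at level
   [n], so the agreed value is [v i]. *)
have Uz : U (word x0 n) by move: Px0; rewrite -UE => /(_ n).
have /st /implyP : CodeSeq.code (word x0 n) < 4 ^ n.
  by rewrite -{2}(size_word x0 n); exact/code_binary_lt/binary_word.
rewrite CodeSeq.codeK size_word binary_word qU Uz eqxx => /(_ isT).
by move=> /andP[lt /eqP <-]; exact: good.
Qed.

(** * Self-reference and the reduction property *)

Definition closed2 (D : Type) (A : baire -> (nat -> D) -> Prop) : Prop :=
  forall p x, (forall n, exists q y, [/\ A q y, agree n p q & agree n x y]) ->
  A p x.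

(* A tree for the section of [A] at [p] whose membership test at [s] reads only
   the first [size s] values of [p]. *)
Definition section_tree (D : Type) (dig : D -> nat)
    (A : baire -> (nat -> D) -> Prop) (p : baire) (s : seq nat) : Prop :=
  s = [::] \/
  exists q y, [/\ A q y, agree (size s) p q & map dig (mkseq y (size s)) = s].

Lemma section_tree_local (D : Type) (dig : D -> nat)
    (A : baire -> (nat -> D) -> Prop) p q s : agree (size s) p q ->
  section_tree dig A p s -> section_tree dig A q s.
Proof.
move=> pq [|[r [y [Ary pr ys]]]]; [by left|right].
exists r, y; split=> //; exact: agree_trans (agree_sym pq) pr.
Qed.

Lemma section_tree_prefix (D : Type) (dig : D -> nat)
    (A : baire -> (nat -> D) -> Prop) p s t : prefix s t ->
  section_tree dig A p t -> section_tree dig A p s.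
Proof.
move=> st [e|[q [y [Aqy pq ty]]]].
  by left; move: st; rewrite e prefixs0 => /eqP.
right; exists q, y; split=> //; first by apply: agreeW pq; exact: size_prefix.
have e n : map dig (mkseq y n) = mkseq (dig \o y) n by rewrite /mkseq -map_comp.
by move: st; rewrite -ty !e; exact: prefix_mkseqP.
Qed.

Lemma section_treeP (D : Type) (dig : D -> nat)
    (A : baire -> (nat -> D) -> Prop) p x : injective dig -> closed2 A ->
  (forall n, section_tree dig A p (map dig (mkseq x n))) <-> A p x.
Proof.
move=> dig_inj cA; split=> [H|Apx n]; last first.
  by right; exists p, x; rewrite size_map size_mkseq.
apply: cA => n; have [|[q [y []]]] := H n.+1.
  by move/(congr1 size); rewrite size_map size_mkseq.
rewrite size_map size_mkseq => Aqy pq /(inj_map dig_inj) /agree_mkseq yx.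
exists q, y; split=> //; first exact: agreeW pq.
by apply: agree_sym; apply: agreeW yx.
Qed.

(** Value [k] of the image depends on the first [k] values only, so the [n]-th iterate from any
    start is already right on its first [n] values. *)
Lemma fixed_point (G : baire -> baire) :
  (forall k p q, agree k p q -> G p k = G q k) -> exists p, G p = p.
Proof.
move=> Gl; pose a n := iter n G (fun=> 0).
have aS n : agree n (a n) (a n.+1).
  elim: n => // n IH i; rewrite ltnS => le; apply: Gl.
  exact: agreeW IH.
have aA m n : m <= n -> agree m (a m) (a n).
  elim: n => [|n IH]; first by rewrite leqn0 => /eqP->.
  rewrite leq_eqVlt => /orP[/eqP->//|le]; apply: (agree_trans (IH le)).
  exact: (agreeW (n := m) (m := n) le (aS n)).
exists (fun k => a k.+1 k); apply/funext => k; apply: Gl => i lti.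
by rewrite (aA _ _ lti).
Qed.

(* Since the tree at [s] reads only [size s <= code s] values of the name, a name
   can be chosen that names the tree it defines. *)
Lemma self_reference (D : discreteTopologicalType) (dig : D -> nat)
    (A : baire -> (nat -> D) -> Prop) : injective dig -> closed2 A ->
  exists p T, [/\ tree_over dig T, forall s, p (CodeSeq.code s) = T s :> nat &
    forall x : pts D, paths dig T x <-> A p x].
Proof.
move=> dig_inj cA.
pose G (p : baire) k :=
  nat_of_bool `[< section_tree dig A p (CodeSeq.decode k) >].
have [p Gp] : exists p, G p = p.
  apply: fixed_point => k p q pq; congr nat_of_bool; apply: asbool_equiv_eq.
  have pq' : agree (size (CodeSeq.decode k)) p q.
    by apply: agreeW pq; rewrite -{2}[k]CodeSeq.decodeK size_code.
  split; apply: section_tree_local => //; exact: agree_sym.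
exists p, (fun s => `[< section_tree dig A p s >]); split.
- split; [split|].
  + by exists [::]; apply/asboolP; left.
  + by move=> s t st /asboolP Tt; apply/asboolP; exact: section_tree_prefix Tt.
  + move=> s /asboolP[->|[q [y [_ _ <-]]]]; [by exists [::]|by eexists].
- by move=> s; rewrite -{1}Gp /G CodeSeq.codeK.
- move=> x; rewrite -(section_treeP p x dig_inj cA).
  by split=> H n; [apply/asboolP; exact: H|apply/asboolP; exact: H].
Qed.

Definition strategy (f : baire) (s t : seq nat) (a : nat) : nat :=
  f (cpair (CodeSeq.code s) (cpair (CodeSeq.code t) a)).

(* [f] codes a simulation of [E] by [E'] from the position [([::], t0)]: positions
   are the pairs [(s, t)] where [strategy f s t] is positive, and the child
   [rcons s a] is answered by the child [rcons t (strategy f s t a).-1]. *)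
Definition simulation (E E' : seq nat -> Prop) (t0 : seq nat) (f : baire) : Prop :=
  (forall a, strategy f [::] t0 a <> 0) /\
  forall s t a b, strategy f s t a = b.+1 -> E' t /\
    (E (rcons s a) -> forall a', strategy f (rcons s a) (rcons t b) a' <> 0).

Lemma simulation_of_rel E E' t0 (R : seq nat -> seq nat -> Prop) :
  R [::] t0 ->
  (forall s t, R s t -> E' t /\
     forall a, E (rcons s a) -> exists b, R (rcons s a) (rcons t b)) ->
  exists f, simulation E E' t0 f.
Proof.
move=> R0 RS.
have H (x : seq nat * seq nat * nat) : exists b, let: (s, t, a) := x in
    R s t -> E (rcons s a) -> R (rcons s a) (rcons t b).
  case: x => [[s t] a]; have [[Rst Es]|n] := pselect (R s t /\ E (rcons s a)).
    by have [b Rb] := (RS _ _ Rst).2 a Es; exists b.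
  by exists 0 => Rst Es; case: n.
have [g Hg] := choice H.
pose f k := let s := CodeSeq.decode (Cantor.of_nat k).1 in
  let t := CodeSeq.decode (Cantor.of_nat (Cantor.of_nat k).2).1 in
  if `[< R s t >] then (g (s, t, (Cantor.of_nat (Cantor.of_nat k).2).2)).+1
  else 0.
have fE s t a : strategy f s t a = if `[< R s t >] then (g (s, t, a)).+1 else 0.
  by rewrite /strategy /f /=; do 2!rewrite of_cpair /=; rewrite !CodeSeq.codeK.
exists f; split=> [a|s t a b]; first by rewrite fE (asboolT R0).
rewrite fE; case: asboolP => // Rst [<-]; have [E't _] := RS _ _ Rst.
split=> // Es a'; rewrite fE (asboolT (Hg (s, t, a) Rst Es)) //.
Qed.

(** Comparability of ranks without ordinals. The union [le] of all simulations is one itself. If it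
    omits the pair of roots, some child [c] of the root of [E] is simulated by no child of the root
    of [E'], and then [E'] is simulated by [E] from [c] on. *)
Lemma simulation_total (E E' : seq nat -> Prop) : E [::] -> E' [::] ->
  (exists f, simulation E E' [::] f) \/ (exists c f, simulation E' E [:: c] f).
Proof.
move=> E0 E'0.
pose ok (R : seq nat -> seq nat -> Prop) := forall s t, R s t -> E' t /\
     forall a, E (rcons s a) -> exists b, R (rcons s a) (rcons t b).
pose le s t := exists2 R, ok R & R s t.
have ok_le : ok le.
  move=> s t [R okR Rst]; have [E't H] := okR _ _ Rst; split=> // a /H [b Rb].
  by exists b, R.
have [le0|nle0] := pselect (le [::] [::]).
  by left; exact: simulation_of_rel le0 ok_le.
have nle s t : E' t -> ~ le s t -> exists a, E (rcons s a) /\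
    forall b, ~ le (rcons s a) (rcons t b).
  move=> E't nst; apply: contrapT => H; apply: nst.
  exists (fun s' t' => (s' = s /\ t' = t) \/ le s' t'); last by left.
  move=> s' t' [[-> ->]|/ok_le [E't' H']]; last first.
    by split=> // a /H' [b leb]; exists b; right.
  split=> // a Ea; apply: contrapT => Hb; apply: H; exists a; split=> // b leb.
  by apply: Hb; exists b; right.
right; have [c [Ec Hc]] := nle _ _ E'0 nle0; exists c.
apply: (@simulation_of_rel E' E [:: c]
  (fun t s => E s /\ forall b, ~ le s (rcons t b))).
  by split.
move=> t s [Es Hs]; split=> // b E'b.
by have [a [Ea Ha]] := nle _ _ E'b (Hs b); exists a.
Qed.

(** Each clause concerns finitely many values of [f], and membership in a section tree is settled by
    finitely many values of [p], so it may also occur as a hypothesis. *)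
Lemma closed2_simulation (B B' : baire -> baire -> Prop) t0 :
  closed2 (fun p f => simulation (section_tree id B p) (section_tree id B' p) t0 f).
Proof.
move=> p f H.
have Hs s t a : exists n, forall g, agree n f g -> strategy f s t a = strategy g s t a.
  by eexists => g; apply; exact: leqnn.
split=> [a|s t a b fb].
  have [n Hn] := Hs [::] t0 a; have [q [g [[g0 _] _ fg]]] := H n.
  by rewrite (Hn g fg).
split=> [|Es a'].
  have [n Hn] := Hs s t a; have [q [g [[_ gS] pq fg]]] := H (maxn n (size t)).
  have [|E't _] := gS s t a b.
    by rewrite -Hn //; apply: agreeW fg; rewrite leq_maxl.
  apply: section_tree_local E't; apply: agree_sym; apply: agreeW pq.
  by rewrite leq_maxr.
have [n Hn] := Hs s t a; have [m Hm] := Hs (rcons s a) (rcons t b) a'.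
have [q [g [[_ gS] pq fg]]] := H (maxn n (maxn m (size (rcons s a)))).
have [|_ /(_ _ a')] := gS s t a b.
  by rewrite -Hn //; apply: agreeW fg; rewrite leq_maxl.
rewrite -Hm; last by apply: agreeW fg; rewrite !leq_max leqnn orbT.
apply; apply: section_tree_local Es; apply: agreeW pq.
by rewrite !leq_max leqnn !orbT.
Qed.

Definition tail (T : Type) (x : nat -> T) : nat -> T := fun i => x i.+1.

(** The answers to the successive initial segments of [y] never leave the second tree. *)
Lemma simulation_path (E : seq nat -> Prop) (B : baire -> baire -> Prop) p t0 f y :
  closed2 B -> (forall n, E (mkseq y n)) ->
  simulation E (section_tree id B p) t0 f -> exists x, B p x.
Proof.
move=> cB Ey [f0 fS].
pose t := fix t n := if n is n'.+1 then
  rcons (t n') (strategy f (mkseq y n') (t n') (y n')).-1 else t0.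
have inv n : forall a, strategy f (mkseq y n) (t n) a <> 0.
  elim: n => // n IH a'; have := fS (mkseq y n) (t n) (y n) _ (esym (prednK _)).
  rewrite lt0n => /(_ (introN eqP (IH _))) [_].
  by rewrite -mkseqS; apply.
have vis n : section_tree id B p (t n).
  have := fS (mkseq y n) (t n) 0 _ (esym (prednK _)).
  by rewrite lt0n => /(_ (introN eqP (inv n 0))) [].
have [x xt] := @chain_limit _ t _ (fun n => erefl).
exists x; apply/(section_treeP p x (@inj_id nat) cB) => n; rewrite map_id.
apply: section_tree_prefix (vis n); rewrite -xt; apply: prefix_mkseq.
by elim: (n) => //= m; rewrite size_rcons ltnS.
Qed.

(** Played against each other, [f] and [g] would give rank inequalities of which one is strict.
    Concretely, starting with [c], each answer of [g] prolongs a branch of the first tree, and [f]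
    supplies the next move for [g]. *)
Lemma simulation_cycle (E' : seq nat -> Prop) (B : baire -> baire -> Prop) p c f g :
  closed2 B ->
  simulation (section_tree id B p) E' [::] f ->
  simulation E' (section_tree id B p) [:: c] g -> exists x, B p x.
Proof.
move=> cB [f0 fS] [g0 gS].
pose st := fix st n := if n is n'.+1 then
  let: (u, t, d) := st n' in
  let b := (strategy f u t d).-1 in
  (rcons u d, rcons t b, (strategy g t (rcons u d) b).-1) else ([::], [::], c).
pose u n := (st n).1.1; pose t n := (st n).1.2; pose d n := (st n).2.
have inv n : (forall a, strategy f (u n) (t n) a <> 0) /\
             (forall a, strategy g (t n) (rcons (u n) (d n)) a <> 0).
  elim: n => [|n]; first by [].
  rewrite /u /t /d /=; case: (st n) => [[v w] e] /= [If Ig].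
  set b := (strategy f v w e).-1; set h := (strategy g w (rcons v e) b).-1.
  have eb : strategy f v w e = b.+1 by rewrite /b prednK // lt0n; exact/eqP.
  have eh : strategy g w (rcons v e) b = h.+1.
    by rewrite /h prednK // lt0n; exact/eqP.
  have [Ev Ig'] := gS _ _ _ _ eh; have [_ If'] := fS _ _ _ _ eb.
  have If2 := If' Ev; split=> //; apply: Ig'.
  have ez : strategy f (rcons v e) (rcons w b) 0
      = (strategy f (rcons v e) (rcons w b) 0).-1.+1.
    by rewrite prednK // lt0n; exact/eqP/If2.
  by have [] := fS _ _ _ _ ez.
have vis n : section_tree id B p (rcons (u n) (d n)).
  have [_ Ig] := inv n.
  have ez : strategy g (t n) (rcons (u n) (d n)) 0
      = (strategy g (t n) (rcons (u n) (d n)) 0).-1.+1.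
    by rewrite prednK // lt0n; exact/eqP/Ig.
  by have [] := gS _ _ _ _ ez.
have uS n : u n.+1 = rcons (u n) (d n).
  by rewrite /u /d /=; case: (st n) => [[v w] e].
have [x xu] := chain_limit uS.
exists x; apply/(section_treeP p x (@inj_id nat) cB) => n; rewrite map_id.
have su : size (u n) = n.
  by elim: (n) => // m IH; rewrite uS size_rcons IH.
rewrite -{1}su xu; apply: section_tree_prefix (vis n).
exact: prefix_rcons.
Qed.

(* The reduction property of coanalytic sets, applied to {p | B0 p is empty} and
   {p | B1 p is empty}: [A0 p] is inhabited iff the rank of the tree of [B0 p] is
   at most that of [B1 p], and [A1 p] iff it is larger. *)
Lemma coanalytic_reduction (B0 B1 : baire -> baire -> Prop) :
  closed2 B0 -> closed2 B1 ->
  exists A0 A1 : baire -> baire -> Prop, [/\ closed2 A0, closed2 A1 & forall p,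
    [/\ (exists x, A0 p x) \/ (exists x, A1 p x),
        (exists x, A0 p x) -> (exists x, B0 p x) -> exists x, B1 p x,
        (exists x, A1 p x) -> (exists x, B1 p x) -> exists x, B0 p x &
        (exists x, A0 p x) -> (exists x, A1 p x) -> exists x, B0 p x]].
Proof.
move=> c0 c1.
pose E0 := section_tree id B0; pose E1 := section_tree id B1.
exists (fun p f => simulation (E0 p) (E1 p) [::] f).
(* The starting child is stored as entry 0 of the point, the strategy in its tail. *)
exists (fun p f => simulation (E1 p) (E0 p) [:: f 0] (tail f)).
split; first exact: closed2_simulation.
  move=> p f H; apply: (@closed2_simulation B1 B0 [:: f 0]) => n.
  have [q [g [gS pq fg]]] := H n.+1; exists q, (tail g); split.
  - by rewrite (fg 0).
  - exact: agreeW pq.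
  - by move=> i lti; exact: (fg i.+1).
have path0 p y n : B0 p y -> E0 p (mkseq y n).
  by move=> /(section_treeP p y (@inj_id nat) c0) /(_ n); rewrite map_id.
have path1 p y n : B1 p y -> E1 p (mkseq y n).
  by move=> /(section_treeP p y (@inj_id nat) c1) /(_ n); rewrite map_id.
move=> p; split.
- have [||[f Hf]|[c [f Hf]]] := @simulation_total (E0 p) (E1 p).
  + by left.
  + by left.
  + by left; exists f.
  + by right; exists (fun i => if i is j.+1 then f j else c).
- by move=> [f Hf] [y By]; apply: (simulation_path (y := y) c1 _ Hf) => n; exact: path0.
- by move=> [f Hf] [y By]; apply: (simulation_path (y := y) c0 _ Hf) => n; exact: path1.
- by move=> [f Hf] [g Hg]; exact: (simulation_cycle c0 Hf Hg).
Qed.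

(** * Separations *)

Lemma not_eval_closed c k m (p : baire) :
  (forall n, exists2 q, ~ eval q c k m & agree n p q) -> ~ eval p c k m.
Proof. by move=> H /eval_use [N HN]; have [q nq /HN] := H N. Qed.

(** Not answering 0 is a closed condition on [p], meaningful even where the program diverges. By
    [aliveE] it is membership in the computed tree wherever the reduction is defined. *)
Definition alive (c : code) (p : baire) (s : seq nat) : bool :=
  `[< ~ eval p c (CodeSeq.code s) 0 >].

Lemma aliveE (Phi : baire -> option baire) c p p' (T : pred (seq nat)) :
  (forall p q, Phi p = Some q -> forall n, eval p c n (q n)) ->
  Phi p = Some p' -> (forall s, p' (CodeSeq.code s) = T s) ->
  alive c p = T.
Proof.
move=> Hc /Hc ev pT; apply/funext => s; have := ev (CodeSeq.code s); rewrite pT.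
move=> evs; apply/asboolP/idP => [n0|Ts /(eval_functional evs)].
  by apply: contrapT => /negP nT; apply: n0; move: evs; rewrite (negbTE nT).
by rewrite Ts.
Qed.

Lemma perfect_test_mono (b b' : bool) k v j v' : (b -> b') ->
  perfect_test b k v j v' -> perfect_test b' k v j v'.
Proof.
move=> bb' /andP[H0 H]; apply/andP; split=> //; apply/implyP => /(implyP H).
by move=> /andP[/bb' ->].
Qed.

Definition forces (c : code) (sigma : seq nat) (b : bool) : Prop :=
  exists2 m, (m == 0) = b & forall q : baire,
    (forall i, i < size sigma -> q i = nth 0 sigma i) -> eval q c 0 m.

Definition tree_fragment (sigma : seq nat) : Prop :=
  exists2 T : pred (seq nat), forall s t, prefix s t -> T t -> T s &
    forall i, i < size sigma -> nth 0 sigma i = T (CodeSeq.decode i).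

(* For each finite part [sigma] of the name of a tree that forces the answer [b],
   the point [y] gives a string excluded by [sigma], and a perfect subtree of the
   tree computed from [p] that passes through this string. *)
Definition no_answer (cP cS : code) (b : bool) (p y : baire) : Prop :=
  forall k, let sigma := CodeSeq.decode k in
  tree_fragment sigma -> forces cS sigma b ->
  [/\ y (cpair k 0) < size sigma, nth 0 sigma (y (cpair k 0)) = 0,
      perfect_code (alive cP p) (fun m => y (cpair k m.+1)) &
      members (fun m => y (cpair k m.+1)) (CodeSeq.decode (y (cpair k 0)))].

(** [alive] occurs only positively in the test, and a string that is not alive at [p] is not alive
    at any oracle close to [p]. Everything else reads finitely many values of [y]. *)
Lemma closed2_no_answer cP cS b : closed2 (no_answer cP cS b).
Proof.
move=> p y H k sigma tf fs.
have E n : exists q z, [/\ y (cpair k 0) < size sigma,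
    nth 0 sigma (y (cpair k 0)) = 0,
    perfect_code (alive cP q) (fun m => z (cpair k m.+1)),
    members (fun m => z (cpair k m.+1)) (CodeSeq.decode (y (cpair k 0))) &
    agree n p q /\ agree n y z].
  have [q [z [nz pq yz]]] := H (maxn n (cpair k 0).+1).
  have e : y (cpair k 0) = z (cpair k 0) by rewrite yz // leq_max leqnn orbT.
  have [? ? ? ?] := nz k tf fs; exists q, z; rewrite e; split=> //.
  by split; [apply: agreeW pq|apply: agreeW yz]; rewrite leq_maxl.
split; try by have [? [? []]] := E 0.
- move=> i j.
  have [N HN] : exists N, forall q, agree N p q ->
      alive cP q (CodeSeq.decode i) -> alive cP p (CodeSeq.decode i).
    have [ev|nev] := pselect (eval p cP (CodeSeq.code (CodeSeq.decode i)) 0).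
      have [N HN] := eval_use ev; exists N => q pq /asboolP nq.
      by case: nq; exact: HN.
    by exists 0 => q _ _; apply/asboolP.
  pose a := cpair k i.+1; pose d := cpair k j.+1.
  have [q [z [_ _ pz _ [pq yz]]]] := E (maxn N (maxn a.+1 d.+1)).
  rewrite !yz ?leq_max ?leqnn ?orbT //.
  apply: perfect_test_mono (pz i j); apply: HN.
  by apply: agreeW pq; rewrite leq_maxl.
- rewrite /members CodeSeq.decodeK; set i := y (cpair k 0).
  have [q [z [_ _ _ + [_ yz]]]] := E (cpair k i.+1).+1.
  by rewrite /members CodeSeq.decodeK -/i yz.
Qed.

Lemma C_not_le_PST_baire : ~ sW_le C_baire PST_baire.
Proof.
move=> [Phi [Psi [[cP HP] [cS HS] H]]].
have [A0 [A1 [cA0 cA1 HA]]] :=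
  coanalytic_reduction (@closed2_no_answer cP cS true)
                       (@closed2_no_answer cP cS false).
(* The sets are crossed over: [A0] belongs to digit 0, but solutions with digit 0 are taken from
   [A1], so the winning digit gets no solution. *)
pose S p (x : nat -> nat) := if x 0 == 0 then A1 p (tail x) else A0 p (tail x).
have cS' : closed2 S.
  move=> p x Hx; rewrite /S; case: eqP => x0; [apply: cA1|apply: cA0] => n;
  have [q [y [+ pq xy]]] := Hx n.+1; rewrite /S -(xy 0) //; case: eqP => // _ Sq;
  exists q, (tail y); (split=> //; first exact: agreeW pq);
  by move=> i lti; exact: (xy i.+1).
have [p [T [tT pT TS]]] := @self_reference nat id S (@inj_id nat) cS'.
have [H1 H2 H3 H4] := HA p.
have [x nx xE] := closed_name_intro tT pT erefl.
have xne : cset x !=set0.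
  rewrite xE; case: H1 => [[f Hf]|[f Hf]].
    by exists (fun i => if i is j.+1 then f j else 1); apply/TS.
  by exists (fun i => if i is j.+1 then f j else 0); apply/TS.
have [p' [y [ep' /closed_name_entries [T' [tT' _ pT' TE]] unc sol]]] := H p x nx xne.
have aT := aliveE HP ep' pT'.
have T'p := tT'.1.2.
have [|w0 pw0 w0K] := perfect_kernel T'p; first by rewrite TE.
have [w00 _ w0p _] := (perfect_codeP _ _).1 pw0.
have [subK neK perK] := perfect_code_perfect pw0.
pose evidence b := exists sigma, [/\ tree_fragment sigma, forces cS sigma b &
  forall i, i < size sigma -> nth 0 sigma i = 0 ->
            ~~ members w0 (CodeSeq.decode i)].
(* A witness for [no_answer] would put a string excluded by [sigma] on a perfect subtree, hence into
   the kernel. *)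
have C1 b : evidence b -> ~ exists z, no_answer cP cS b p z.
  move=> [sigma [tf fs ev]] [z Hz]; have := Hz (CodeSeq.code sigma).
  rewrite CodeSeq.codeK aT => /(_ tf fs) [lt s0 pz mz].
  by have /negP := ev _ lt s0; apply; apply/w0K; exact: perfect_code_uncountable mz.
have C2 b : ~ evidence b -> exists z, no_answer cP cS b p z.
  move=> nev.
  have Hk k : exists i, let sigma := CodeSeq.decode k in
      tree_fragment sigma -> forces cS sigma b ->
      [/\ i < size sigma, nth 0 sigma i = 0 & members w0 (CodeSeq.decode i)].
    apply: contrapT => nk; apply: nev; exists (CodeSeq.decode k).
    split; try by apply: contrapT => n; apply: nk; exists 0.
    by move=> i lti si; apply/negP => mi; apply: nk; exists i.
  have [f Hf] := choice Hk.
  exists (fun n => let: (k, m) := Cantor.of_nat n in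
                   if m is m'.+1 then w0 m' else f k).
  move=> k sigma tf fs; rewrite !of_cpair aT.
  have -> : (fun m => let: (k, m) := Cantor.of_nat (cpair k m.+1) in
                   if m is m'.+1 then w0 m' else f k) = w0.
    by apply/funext => m; rewrite of_cpair.
  by have [] := Hf k tf fs.
have C3 b : evidence b -> if b then exists z, A1 p z else exists z, A0 p z.
  move=> [sigma [[T0 T0p sT0] [m mb fs] ev]].
  (* The kernel together with the finitely many strings that [sigma] accepts: a tree with the same
     paths whose name extends [sigma], so the answer must start with the digit [b]. *)
  pose U s := members w0 s || has (fun i => (nth 0 sigma i != 0) &&
     prefix s (CodeSeq.decode i)) (iota 0 (size sigma)).
  have Up s t : prefix s t -> U t -> U s.
    move=> st; rewrite /U => /orP[/(w0p _ _ st) ->//|/hasP[i ii /andP[i0 ti]]].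
    apply/orP; right; apply/hasP; exists i => //; rewrite i0.
    exact: prefix_trans ti.
  have UE : npaths U = npaths (members w0).
    apply/seteqP; split=> z /npathsP Uz; apply/npathsP => n; last by rewrite /U Uz.
    (* A string accepted by [sigma] has length below [size sigma], so longer initial segments of [z]
       lie in the kernel. *)
    apply: w0p (prefix_mkseq z (leq_addr (size sigma) n)) _.
    have /orP[//|/hasP[i]] := Uz (n + size sigma).
    rewrite mem_iota add0n => lti /andP[_ /size_prefix].
    rewrite size_mkseq => le; have := size_code (CodeSeq.decode i).
    rewrite CodeSeq.decodeK => le'.
    by have := leq_trans (leq_trans lti (leq_addl n _)) (leq_trans le le');
       rewrite ltnn.
  pose q : baire := fun k => U (CodeSeq.decode k).
  have [||Q nQ QE] := closed_name_intro (D := nat) (dig := id) (p := q) (T := U)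
    _ _ erefl.
  - split; [split=> //|by move=> s _; exists s; rewrite map_id].
    by exists [::]; rewrite /U w00.
  - by move=> s; rewrite /q CodeSeq.codeK.
  have [|q' [w [eq' <- xw]]] := sol q Q nQ.
    by rewrite /= QE UE -TE.
  have qs i : i < size sigma -> q i = nth 0 sigma i.
    move=> lti; rewrite sT0 //; congr nat_of_bool.
    apply/idP/idP => [/orP[mi|/hasP[j]]|T0i].
    - apply: contrapT => /negP nT; have i0 : nth 0 sigma i = 0.
        by rewrite sT0 // (negbTE nT).
      by have := ev i lti i0; rewrite mi.
    - rewrite mem_iota add0n => ltj /andP[+ ij]; rewrite sT0 // eqb0 negbK.
      exact: T0p.
    - apply/orP; right; apply/hasP; exists i; first by rewrite mem_iota add0n.
      by rewrite sT0 // T0i prefix_refl.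
  have em : q' 0 = m := eval_functional (HS _ _ eq' 0) (fs q qs).
  move: xw => /=; rewrite xE => /TS; rewrite /S em mb.
  by case: (b) => Aw; exists (tail q').
(* The part of the kernel's own name that is read before the first digit appears is evidence. *)
have C4 : exists b, evidence b.
  pose q : baire := fun k => members w0 (CodeSeq.decode k).
  have [||Q nQ QE] := closed_name_intro (D := nat) (dig := id) (p := q)
    (T := members w0) _ _ erefl.
  - split; [split=> //|by move=> s _; exists s; rewrite map_id].
    by exists [::].
  - by move=> s; rewrite /q CodeSeq.codeK.
  have [|q' [w [eq' _ _]]] := sol q Q nQ; first by rewrite /= QE -TE.
  have [N HN] := eval_use (HS _ _ eq' 0).
  exists (q' 0 == 0), (mkseq q N); split.
  - exists (members w0) => // i; rewrite size_mkseq => lti.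
    by rewrite nth_mkseq.
  - exists (q' 0) => // r; rewrite size_mkseq => qr; apply: HN => i lti.
    by rewrite qr // nth_mkseq.
  - move=> i; rewrite size_mkseq => lti; rewrite nth_mkseq // /q.
    by case: (members _ _).
(* Evidence for one digit makes the set crossed with it inhabited, and the comparison then yields
   evidence for the other digit. Both sets are inhabited, so [no_answer] for digit 0 is too, against
   the evidence. *)
have [ev|ev] : evidence true \/ evidence false.
  by have [[] ev] := C4; [left|right].
- have a1 := C3 _ ev; have nb0 := C1 _ ev.
  have [//|b1] := pselect (exists z, no_answer cP cS false p z).
    by move=> /(H3 a1).
  apply: nb0; apply: H4 a1; apply: (C3 false); apply: contrapT => /C2; exact: b1.
- have a0 := C3 _ ev; have nb1 := C1 _ ev.
  have nb0 : ~ exists z, no_answer cP cS true p z by move=> /(H2 a0).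
  apply: (nb0); apply: H4 a0 _; apply: (C3 true).
  by apply: contrapT => /C2.
Qed.

(** * Perfect subsets do not reduce to unique choice *)

Lemma use_uniform (P : seq bool -> nat -> Prop) n :
  (forall s m k, m <= k -> P s m -> P s k) ->
  (forall s, size s = n -> exists N, P s N) ->
  exists N, forall s, size s = n -> P s N.
Proof.
elim: n P => [|n IH] P mono H.
  by have [N HN] := H [::] erefl; exists N => s /size0nil ->.
have Hb b : exists N, forall s, size s = n -> P (b :: s) N.
  apply: IH => [s m k|s sn]; first exact: mono.
  by apply: H; rewrite /= sn.
have [N0 H0] := Hb false; have [N1 H1] := Hb true.
exists (maxn N0 N1) => -[//|[] s [sn]].
  by apply: mono (H1 s sn); rewrite leq_maxr.
by apply: mono (H0 s sn); rewrite leq_maxl.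
Qed.

Lemma size_dec u : binary u -> size (dec u) <= size u.
Proof.
move=> /dec_runK e; rewrite {2}e size_cat.
exact: leq_trans (size_enc _) (leq_addr _ _).
Qed.

Lemma word_false (z : pts bool) n : z 0 = false ->
  word z n.+1 = 0 :: map nat_of_bool (mkseq (tail z) n).
Proof.
move=> z0; rewrite /word /mkseq /= z0 (iotaDl 1 0 n) -!map_comp.
by congr (_ :: _).
Qed.

Lemma enc_path_head w : enc_path w 0 = ~~ (w 0 == 0).
Proof. by rewrite /enc_path /=; case: (w 0). Qed.

Lemma PST_cantor_not_le_UC : ~ sW_le PST_cantor UC_baire.
Proof.
move=> [Phi [Psi [[cP HP] [cS HS] H]]].
pose live p (v : nat -> nat) := forall n, alive cP p (mkseq v n).
pose wd (s : seq bool) := CodeSeq.code (0 :: map nat_of_bool s).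
(* [B0] and [B1] say that the tree computed from the unique path of the tree
   alive at p has, resp. has not, a path starting with 0. *)
pose B0 p w := live p (tail w) /\
  forall n, exists2 s : seq bool, size s = n & ~ eval (tail w) cS (wd s) 0.
pose B1 p w := live p (tail w) /\
  forall s : seq bool, size s = w 0 -> ~ eval (tail w) cS (wd s) 1.
have cl p w : (forall n, exists q z, [/\ live q (tail z), agree n p q & agree n w z]) ->
    live p (tail w).
  move=> Hpw n; apply/asboolP; apply: (@not_eval_closed _ _ _ p) => m.
  have [q [z [lz pq wz]]] := Hpw (maxn m n.+1).
  exists q; last by apply: agreeW pq; rewrite leq_maxl.
  have /agree_mkseq -> : agree n (tail w) (tail z).
    by move=> i lti; apply: wz; rewrite leq_max ltnS lti orbT.
  by have /asboolP := lz n.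
have tail_agree n (w z : nat -> nat) : agree n.+1 w z -> agree n (tail w) (tail z).
  by move=> wz i lti; exact: (wz i.+1).
have cB0 : closed2 B0.
  move=> p w Hpw; split.
    by apply: cl => n; have [q [z [[lz _] ? ?]]] := Hpw n; exists q, z.
  move=> n; apply: contrapT => ns.
  (* Only finitely many words have length [n], so if all are rejected, one finite part of the oracle
     shows it. *)
  have [||N HN] := @use_uniform (fun s N => forall z, agree N (tail w) z ->
      eval z cS (wd s) 0) n.
  - by move=> s m k mk Hs z wz; apply: Hs; exact: agreeW wz.
  - move=> s sn; apply: eval_use; apply: contrapT => nev; apply: ns.
    by exists s.
  have [q [z [[_ /(_ n) [s sn nz]] _ /tail_agree wz]]] := Hpw N.+1.
  by apply: nz; exact: HN.
have cB1 : closed2 B1.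
  move=> p w Hpw; split.
    by apply: cl => n; have [q [z [[lz _] ? ?]]] := Hpw n; exists q, z.
  move=> s sw; apply: not_eval_closed => n.
  have [q [z [[_ Hz] _ wz]]] := Hpw n.+1; exists (tail z); last exact: tail_agree.
  by apply: Hz; rewrite sw wz.
have [A0 [A1 [cA0 cA1 HA]]] := coanalytic_reduction cB0 cB1.
(* A code starts with bit 0 exactly if the first entry is 0, so [A0] goes to one half of Cantor
   space and [A1] to the other. Halving makes an inhabited half uncountable. *)
pose A p (w : nat -> nat) :=
  if w 0 == 0 then A0 p (half \o tail w) else A1 p (half \o tail w).
have cA : closed2 A.
  move=> p w Hpw; rewrite /A; case: eqP => w0; [apply: cA0|apply: cA1] => n;
  have [q [z [+ pq wz]]] := Hpw n.+1; rewrite /A -(wz 0) //; case: eqP => // _ Az;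
  exists q, (half \o tail z); (split=> //; first exact: agreeW pq);
  by move=> i lti /=; congr half; exact: (wz i.+1).
(* A decoded word is no longer than the word itself, so this condition reads few enough values of
   [p] to be closed. *)
pose X p (x : nat -> bool) := forall n, section_tree id A p (dec (word x n)).
have cX : closed2 X.
  move=> p x Hpx n; have [q [z [Xz pq xz]]] := Hpx n.
  rewrite (agree_word n x z).1 //.
  apply: section_tree_local (Xz n); apply: agree_sym; apply: agreeW pq.
  by rewrite -{2}(size_word z n) size_dec // binary_word.
have [p [T [tT pT TX]]] := @self_reference bool nat_of_bool X nat_of_bool_inj cX.
pose E (s : seq nat) := `[< section_tree id A p s >].
have Ep s t : prefix s t -> E t -> E s.
  by move=> st /asboolP Et; apply/asboolP; exact: section_tree_prefix Et.
have EA (w : pts nat) : npaths E w <-> A p w.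
  rewrite npathsP -(section_treeP p w (@inj_id nat) cA).
  by split=> Hw n; have := Hw n; rewrite map_id => /asboolP.
have TE : paths nat_of_bool T = paths nat_of_bool (cantorize E).
  apply/seteqP; split=> x.
    move=> /TX Xx n; rewrite /cantorize binary_word /=; apply/asboolP.
    exact: Xx.
  by move=> Ex; apply/TX => n; have /andP[_ /asboolP] := Ex n.
have [H1 H2 H3 H4] := HA p.
have [x nx xE] := closed_name_intro tT pT erefl.
have unc : ~ countable (cset x).
  rewrite xE TE; apply: cantorize_uncountable => // /countable_injP [f finj].
  have [c [v Hv]] : exists c (v : pts nat), forall w : pts nat, half \o w = v ->
      A p (fun i => if i is j.+1 then w j else c).
    by case: H1 => -[v Av]; [exists 0, v|exists 1, v] => w e; rewrite /A /= -e in Av *.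
  apply: (uncountable_half Hv); apply/countable_injP.
  exists (fun w => f (fun i => if i is j.+1 then w j else c)) => w w'.
  rewrite !inE => Aw Aw' e; apply/funext => i.
  have := finj _ _ _ _ e; rewrite !inE => /(_ ((EA _).2 Aw) ((EA _).2 Aw')) e'.
  by have := congr1 (@^~ i.+1) e'.
have [p' [y [ep' /closed_name_entries [V [tV _ pV VE]] [v yv] sol]]] := H p x nx unc.
have aV := aliveE HP ep' pV.
have liveP (w : nat -> nat) : live p w <-> w = v.
  rewrite /live aV; have -> : (forall n, V (mkseq w n)) <-> npaths V w.
    by rewrite npathsP.
  by rewrite VE yv.
(* A point of Baire space is its own name, so [v] is the oracle from which the perfect set is
   computed. *)
have [|q [P [eq /closed_name_entries [U [tU _ qU UE]] [Px [x0 Px0] pP]]]] :=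
  sol v v erefl; first by rewrite /= yv.
have ev s : eval v cS (wd s) (U (0 :: map nat_of_bool s)).
  by rewrite -qU; exact: HS.
have evN s m : eval v cS (wd s) m -> m = U (0 :: map nat_of_bool s).
  by move=> /eval_functional; apply.
have PA z : cset P z -> if z 0 then exists f, A1 p f else exists f, A0 p f.
  move=> Pz; have [w [Pw /(_ 0 isT) -> _]] := perfect_enc_path 1 pP Pz.
  have : A p w.
    apply/EA/(cantorize_enc_path _ Ep); rewrite -TE -xE; exact: Px.
  by rewrite enc_path_head /A; case: eqP => _ Aw; exists (half \o tail w).
(* If [P] meets the half of bit 0, then [A0] and [B0] are inhabited, hence so is [B1]. As [v] is the
   only live path, its witness contradicts [z]. *)
have [[z Pz z0]|nz] := pselect (exists2 z : pts bool, cset P z & z 0 = false).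
  have := PA z Pz; rewrite z0 => a0.
  have Uz n : U (0 :: map nat_of_bool (mkseq (tail z) n)).
    by rewrite -word_false //; move: Pz; rewrite -UE => /(_ n.+1).
  have [|w [/liveP wv Hw]] := H2 a0.
    exists (fun i => if i is j.+1 then v j else 0); split; first exact/liveP.
    move=> n; exists (mkseq (tail z) n); first by rewrite size_mkseq.
    by move=> /evN; rewrite Uz.
  have := Hw (mkseq (tail z) (w 0)); rewrite size_mkseq wv => /(_ erefl); apply.
  by have := ev (mkseq (tail z) (w 0)); rewrite Uz.
(* By compactness the tree of [P] dies in the half of bit 0 at a finite level [n], which becomes the
   first entry of a witness for [B1]. *)
have [n Un] : exists n, forall s, size s = n -> ~~ U (0 :: map nat_of_bool s).
  apply: contrapT => nn.
  have [||z Uz] := @konig (fun s => U (0 :: map nat_of_bool s)).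
  - move=> s t /prefixP[s' ->]; apply: tU.1.2.
    by rewrite map_cat -cat_cons prefix_prefix.
  - move=> n; apply: contrapT => ns; apply: nn; exists n => s sn; apply/negP => Us.
    by apply: ns; exists s.
  pose z' : pts bool := fun i => if i is j.+1 then z j else false.
  apply: nz; exists z' => //; rewrite -UE => -[|n]; first exact: tree_root tU.
  by rewrite -/(word z' n.+1) word_false //; exact: Uz.
have a1 : exists f, A1 p f.
  have := PA x0 Px0; case e : (x0 0) => //.
  by case: nz; exists x0.
have [|w [/liveP wv Hw]] := H3 a1.
  exists (fun i => if i is j.+1 then v j else n); split; first exact/liveP.
  by move=> s sn /evN; rewrite (negbTE (Un s sn)).
have [s sn] := Hw n; rewrite wv; apply.
by have := ev s; rewrite (negbTE (Un s sn)).
Qed.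

Theorem theorem3p6 :
  sW_lt UC_baire PST_cantor /\
  sW_equiv PST_cantor PST_baire /\
  sW_lt PST_baire C_baire.
Proof.
split; [split|split; split].
- exact: UC_le_PST_cantor.
- exact: PST_cantor_not_le_UC.
- exact: PST_cantor_le_baire.
- exact: PST_baire_le_cantor.
- exact: PST_baire_le_C.
- exact: C_not_le_PST_baire.
Qed.
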